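(* Let $H$ be an initial-closed graph with bipartition $\{x_1,\ldots,x_{n-1}\}\cup\{y_1,\ldots,y_{n-1}\}$. Then the following conditions are equivalent: (1) $H$ is Cohen-Macaulay (i.e. $\mathrm{pd}(H)=n-1$), (2) $H$ is unmixed, (3) $\mu(H)=(0,\ldots,0)$, (4) $\mathrm{reg}(H)=1$.
   Context: A graph $G$ on $\{1,\ldots,n\}$ (finite, simple) is closed (with respect to this labelling) if whenever $\{i,j\},\{i,k\}$ ($j\ne k$) are edges with either $i<j,i<k$ or $i>j,i>k$, then $\{j,k\}$ is an edge. A cut point of a connected graph is a vertex whose removal disconnects it. Let $G$ be a connected closed graph on $\{1,\ldots,n\}$, $n\ge2$, without cut point. Its initial-closed graph $H$ is the (connected, bipartite) graph with vertices $x_1,\ldots,x_{n-1}$ and (after renaming $y_j$ as $y_{j-1}$) $y_1,\ldots,y_{n-1}$, where $x_i$ is adjacent to $y_{j-1}$ iff $i<j$ and $\{i,j\}\in E(G)$. Put $\mu(H)=(\mu_1,\ldots,\mu_{n-1})$, $\mu_i:=n-i-\deg_H(x_i)$. Then $\mu_1\ge\cdots\ge\mu_{n-1}=0$ (with $\mu_{n-2}=0$ when $n\ge3$), $\mu_i\le n-2-i$ for $1\le i\le n-3$, and the edge ideal of $H$ is $I(H)=(x_iy_j\mid 1\le i\le n-1,\ i\le j\le n-1-\mu_i)$. For a graph $H$ and a fixed field $\Bbbk$, $\mathrm{pd}(H)$ and $\mathrm{reg}(H)$ denote the projective dimension and regularity of $\Bbbk[V(H)]/I(H)$, with $\mathrm{reg}=\max\{j-i\mid\beta_{i,j}\ne0\}$.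 $H$ is Cohen-Macaulay if $\Bbbk[V(H)]/I(H)$ is; $H$ is unmixed if all minimal vertex covers of $H$ have the same cardinality. *)

(* Defs.v *)
From HB Require Import structures.
From mathcomp Require Import all_boot all_order all_algebra.
From mathcomp Require Import mpoly.

Set Implicit Arguments.
Unset Strict Implicit.
Unset Printing Implicit Defensive.

Import GRing.Theory.
Local Open Scope ring_scope.

Section Graphs.
Variable V : finType.
Implicit Types (e : rel V) (C : {set V}).

Definition simple_graph e : Prop := ssrbool.symmetric e /\ irreflexive e.

Definition connected_graph e : Prop := forall a b, connect e a b.

Definition cut_point e (v : V) : Prop :=
  exists a b, [/\ a != v, b != v &
    ~~ connect [rel x y | [&& e x y, x != v & y != v]] a b].

Definition degree e (v : V) : nat := #|[set w | e v w]|.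

Definition vertex_cover e C : bool :=
  [forall u, forall v, e u v ==> (u \in C) || (v \in C)].

Definition unmixed e : Prop :=
  forall C D, minset (vertex_cover e) C -> minset (vertex_cover e) D ->
  #|C| = #|D|.

End Graphs.

Definition closed_graph n (e : rel 'I_n) : Prop :=
  forall i j k : 'I_n, j != k -> e i j -> e i k ->
  ((i < j)%N && (i < k)%N) || ((j < i)%N && (k < i)%N) -> e j k.

(* The vertices 1, ..., n of G are 0, ..., m in 'I_m.+1, so that n = m.+1.
   inl i stands for x_(i+1) and inr j for the renamed y_(j+1), which comes
   from the vertex j+2 of G, i.e. from lift ord0 j. *)
Definition initial_closed_graph m (e : rel 'I_m.+1) : rel ('I_m + 'I_m)%type :=
  let adj (i j : 'I_m) :=
    let a := widen_ord (leqnSn m) i in let b := lift ord0 j in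
    (a < b)%N && e a b in
  fun u v => match u, v with
             | inl i, inr j | inr j, inl i => adj i j
             | _, _ => false
             end.

(* mu_(i+1) = n - (i+1) - deg x_(i+1), with n = m.+1. *)
Definition mu m (h : rel ('I_m + 'I_m)%type) (i : 'I_m) : nat :=
  (m.+1 - i.+1 - degree h (inl i))%N.

(* Ideals of S = k[x_0, ..., x_(N-1)] are given by lists of generators gs; the
   module under study is S / (gs). *)
Section CommutativeAlgebra.
Variables (k : fieldType) (N : nat).
Notation S := {mpoly k[N]}.
Implicit Types (gs fs : seq S).

Definition in_ideal gs (p : S) : Prop :=
  exists c : 'I_(size gs) -> S, p = \sum_i c i * gs`_i.

(* F_i is free with a basis of gf_rank i elements, the a-th one being of degree
   gf_deg a. Elements of F_i are row vectors, and gf_d i maps F_(i+1) to F_i by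
   v |-> v *m gf_d i; gf_aug maps F_0 to S, and then to S / (gs). *)
Record graded_free_seq := GradedFreeSeq {
  gf_rank : nat -> nat;
  gf_deg : forall i, 'I_(gf_rank i) -> nat;
  gf_d : forall i, 'M[S]_(gf_rank i.+1, gf_rank i);
  gf_aug : 'cV[S]_(gf_rank 0)
}.

Record minimal_graded_free_resolution gs (F : graded_free_seq) : Prop := {
  gf_aug_homog : forall a, gf_aug F a 0 \is (gf_deg a).-homog;
  gf_d_homog : forall i (a : 'I_(gf_rank F i.+1)) (b : 'I_(gf_rank F i)),
    gf_d F i a b != 0 ->
    (gf_deg b <= gf_deg a)%N
      /\ gf_d F i a b \is (gf_deg a - gf_deg b)%N.-homog;
  gf_aug_surj : exists v : 'rV[S]_(gf_rank F 0),
    in_ideal gs ((v *m gf_aug F) 0 0 - 1);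
  gf_exact0 : forall v : 'rV[S]_(gf_rank F 0),
    in_ideal gs ((v *m gf_aug F) 0 0) <-> exists w, v = w *m gf_d F 0;
  gf_exact : forall i (v : 'rV[S]_(gf_rank F i.+1)),
    v *m gf_d F i = 0 <-> exists w, v = w *m gf_d F i.+1;
  gf_minimal : forall i a b, (gf_d F i a b)@_0%MM = 0
}.

Definition betti (F : graded_free_seq) (i j : nat) : nat :=
  #|[set a : 'I_(gf_rank F i) | gf_deg a == j]|.

(* For a homogeneous ideal a minimal graded free resolution exists and is
   unique up to isomorphism, hence beta_(i,j) does not depend on F in the next
   two definitions: pd = max {i | beta_(i,j) != 0 for some j} and
   reg = max {j - i | beta_(i,j) != 0}. *)
Definition has_pd gs (p : nat) : Prop :=
  exists F, [/\ minimal_graded_free_resolution gs F,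
    exists j, betti F p j != 0%N &
    forall i j, betti F i j != 0%N -> (i <= p)%N].

Definition has_reg gs (r : nat) : Prop :=
  exists F, [/\ minimal_graded_free_resolution gs F,
    exists i j, betti F i j != 0%N /\ j = (i + r)%N &
    forall i j, betti F i j != 0%N -> (j <= i + r)%N].

Definition regular_sequence gs fs : Prop :=
  ~ in_ideal (gs ++ fs) 1 /\
  forall i, (i < size fs)%N -> forall p : S,
    in_ideal (gs ++ take i fs) (fs`_i * p) -> in_ideal (gs ++ take i fs) p.

Definition homog_pos_degree fs : Prop :=
  forall f, f \in fs -> exists2 d, (0 < d)%N & f \is d.-homog.

(* Depth of the graded module S / (gs), with respect to the graded maximal
   ideal of S. *)
Definition has_depth gs (d : nat) : Prop :=
  (exists fs, [/\ homog_pos_degree fs, regular_sequence gs fs & size fs = d])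
  /\ forall fs, homog_pos_degree fs -> regular_sequence gs fs ->
     (size fs <= d)%N.

(* P 0 < P 1 < ... < P d are prime ideals of S containing (gs). *)
Definition prime_chain gs (d : nat) (P : nat -> {pred S}) : Prop :=
  (forall i, (i <= d)%N ->
     [/\ idealr_closed (P i), prime_idealr_closed (P i)
       & {subset gs <= P i}])
  /\ forall i, (i < d)%N ->
     {subset P i <= P i.+1} /\ exists2 p, p \in P i.+1 & p \notin P i.

Definition has_krull_dim gs (d : nat) : Prop :=
  (exists P, prime_chain gs d P)
  /\ forall d' P, prime_chain gs d' P -> (d' <= d)%N.

Definition cohen_macaulay gs : Prop :=
  exists d, has_depth gs d /\ has_krull_dim gs d.

End CommutativeAlgebra.

Definition edge_ideal (k : fieldType) (V : finType) (e : rel V) :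
    seq {mpoly k[#|V|]} :=
  [seq 'X_(enum_rank p.1) * 'X_(enum_rank p.2)
     | p : V * V <- enum [pred p : V * V | e p.1 p.2]].

(* Main.v *)
From HB Require Import structures.
From Stdlib Require Import Classical ClassicalEpsilon.
Require Import Defs.
From mathcomp Require Import all_boot all_order all_algebra.
From mathcomp Require Import ring zify.
From mathcomp Require Import mpoly.

(** The hypotheses on G enter only through the shape of H, recorded in
[staircase]: x_i ~ y_j implies i <= j, the neighbours of x_i are consecutive
and start at y_i, the last of them moves weakly to the right with i, and
x_i ~ y_(i+1). Vanishing of mu says that H is [full], i.e. x_i ~ y_j for all
i <= j. Each of the other conditions is shown to be equivalent to fullness.

Let H be a staircase with vertices x_0, y_0, ..., x_(m-1), y_(m-1), let S be
the polynomial ring and I the edge ideal. The edges x_i y_i form a perfect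
matching, so that {x_0, ..., x_(m-1)} is a smallest vertex cover and S/I has
Krull dimension m.

Suppose that H is not full, and let i be the last index with x_i not adjacent
to y_(m-1). The x_a with a > i together with the neighbours of
x_0, ..., x_i form a minimal vertex cover C with more than m elements
([not_full_cover]), and H is not unmixed. The product u of the variables
outside C is not in I but is multiplied into I by each variable of C. Such an
element constrains the homological invariants of S/I in two ways.
- A free resolution of S/I is nonzero in degree |C| ([resolution_length]): the
  variables of C form a regular sequence on S, and reducing the resolution
  modulo one of them after the other moves a nonzero element killed by them
  from one module of the resolution to the next. Hence pd > m.
- A homogeneous regular sequence on S/I has at most 2m - |C| terms
  ([regular_sequence_size]): its terms are algebraically independent modulo
  the annihilator of u, which contains the variables of C. Hence the depth is
  smaller than m.
Moreover, if x_i is not adjacent to y_j, where i < j, then x_i y_i and x_j y_j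
are edges with no edge between them; the Koszul syzygy of these two monomials
is not generated by linear syzygies, so that beta_(2,4) is nonzero
([disjoint_edges_syzygy]) and reg > 1.

Conversely let H be full. An irredundant cover cannot contain both x_i and y_i,
since a neighbour of each outside the cover would give an uncovered edge, so it
has m elements. The differences x_i - y_i form a regular sequence
([full_regular_sequence]), because identifying x_a with y_a for a < i turns I
into a monomial ideal which has no associated prime containing x_i and y_i. And
if the generators x_i y_j are added by increasing j, then by increasing i, each
colon ideal is generated by j <= m - 1 variables; iterating mapping cones gives
a linear resolution of length m ([full_linear_resolution]), hence pd = m and
reg = 1. *)

Set Implicit Arguments.
Unset Strict Implicit.
Unset Printing Implicit Defensive.

Import GRing.Theory.

(** * Ideals and monomial ideals *)

Section Ideals.
Local Open Scope ring_scope.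
Variables (k : fieldType) (N : nat).
Notation S := {mpoly k[N]}.
Implicit Types (A : S -> Prop) (gs hs fs : seq S) (f p q u x y : S).

Definition is_ideal A : Prop :=
  A 0 /\ forall a x y, A x -> A y -> A (a * x + y).

Section IdealTheory.
Variables (A : S -> Prop) (idA : is_ideal A).

Lemma ideal0 : A 0. Proof. by case: idA. Qed.
Lemma idealD x y : A x -> A y -> A (x + y).
Proof. by move=> Ax Ay; rewrite -[x]mul1r; apply: idA.2. Qed.
Lemma idealMl a x : A x -> A (a * x).
Proof. by move=> Ax; rewrite -[_ * _]addr0; apply: idA.2 => //; apply: ideal0. Qed.
Lemma idealMr a x : A x -> A (x * a).
Proof. by rewrite mulrC; apply: idealMl. Qed.
Lemma idealN x : A x -> A (- x).
Proof. by rewrite -mulN1r; apply: idealMl. Qed.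
Lemma idealB x y : A x -> A y -> A (x - y).
Proof. by move=> Ax /idealN; apply: idealD. Qed.
Lemma ideal_sum (I : Type) (r : seq I) (P : pred I) (F : I -> S) :
  (forall i, P i -> A (F i)) -> A (\sum_(i <- r | P i) F i).
Proof. by move=> AF; apply: big_ind => //; [apply: ideal0 | apply: idealD]. Qed.
Lemma idealDr x y : A y -> A (x + y) <-> A x.
Proof.
move=> Ay; split=> [Axy | Ax]; last exact: idealD.
by rewrite -(addrK y x); apply: idealB.
Qed.

End IdealTheory.

Lemma ideal_in_ideal gs : is_ideal (in_ideal gs).
Proof.
split; first by exists (fun=> 0); rewrite big1 // => i _; rewrite mul0r.
move=> a x y [c ->] [d ->]; exists (fun i => a * c i + d i).
by rewrite mulr_sumr -big_split; apply: eq_bigr => i _; rewrite /= mulrDl mulrA.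
Qed.

Lemma mem_in_ideal gs g : g \in gs -> in_ideal gs g.
Proof.
move=> /(nthP 0)[i lti <-]; exists (fun j => (j == Ordinal lti)%:R).
rewrite (bigD1 (Ordinal lti)) //= eqxx mul1r big1 ?addr0 // => j /negbTE->.
by rewrite mul0r.
Qed.

Lemma in_ideal_min A gs p : is_ideal A -> {in gs, forall g, A g} ->
  in_ideal gs p -> A p.
Proof.
move=> idA Ags [c ->]; apply: ideal_sum => // i _.
by apply: idealMl => //; apply/Ags/mem_nth.
Qed.

Lemma in_ideal_sub gs hs p : {subset gs <= hs} ->
  in_ideal gs p -> in_ideal hs p.
Proof.
move=> sub; apply: (@in_ideal_min (in_ideal hs)); first exact: ideal_in_ideal.
by move=> g /sub; apply: mem_in_ideal.
Qed.

Lemma in_ideal_nil p : in_ideal [::] p <-> p = 0.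
Proof.
split; first by case=> c ->; rewrite big_ord0.
by move->; exact: (ideal0 (ideal_in_ideal _)).
Qed.

Lemma in_ideal_rcons gs f p :
  in_ideal (rcons gs f) p <-> exists q, in_ideal gs (p - q * f).
Proof.
split; last first.
  case=> q pq; rewrite -(subrK (q * f) p).
  apply: (idealD (ideal_in_ideal _)).
    by apply: in_ideal_sub pq => g; rewrite mem_rcons inE orbC => ->.
  apply: (idealMl (ideal_in_ideal _)); apply: mem_in_ideal.
  by rewrite mem_rcons mem_head.
apply: (@in_ideal_min (fun p => exists q, in_ideal gs (p - q * f))).
  split; first by exists 0; rewrite mul0r subr0; exact: (ideal0 (ideal_in_ideal _)).
  move=> a x y [q xq] [q' yq']; exists (a * q + q').
  have ->: a * x + y - (a * q + q') * f = a * (x - q * f) + (y - q' * f) by ring.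
  by apply: (ideal_in_ideal gs).2.
move=> g; rewrite mem_rcons inE => /orP[/eqP-> | ggs].
  by exists 1; rewrite mul1r subrr; exact: (ideal0 (ideal_in_ideal _)).
by exists 0; rewrite mul0r subr0; apply: mem_in_ideal.
Qed.

(** Membership in the monomial ideal spanned by the monomials in [M]: an
ideal only when [M] is [upclosed]. *)
Definition mideal (M : pred 'X_{1..N}) p : bool := all M (msupp p).

Definition upclosed (M : pred 'X_{1..N}) : Prop :=
  forall m m', M m -> M (m + m')%MM.

Lemma midealP (M : pred 'X_{1..N}) p :
  reflect (forall m, p@_m != 0 -> M m) (mideal M p).
Proof.
apply: (iffP allP) => H m; first by rewrite -mcoeff_msupp; apply: H.
by rewrite mcoeff_msupp; apply: H.
Qed.

Lemma mcoeffM_neq0 p q m : (p * q)@_m != 0 ->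
  exists m1 m2, [/\ m = (m1 + m2)%MM, p@_m1 != 0 & q@_m2 != 0].
Proof.
rewrite -mcoeff_msupp => /msuppM_le /allpairsP [[m1 m2] /= [h1 h2 ->]].
by exists m1, m2; rewrite -!mcoeff_msupp.
Qed.

Lemma ideal_mideal (M : pred 'X_{1..N}) : upclosed M -> is_ideal (mideal M).
Proof.
move=> upM; split; first by rewrite /mideal msupp0.
move=> a x y /midealP Mx /midealP My; apply/midealP => m.
rewrite mcoeffD; have [-> | nz _] := eqVneq ((a * x)@_m) 0.
  by rewrite add0r; apply: My.
have [m1 [m2 [-> _ /Mx]]] := mcoeffM_neq0 nz.
by rewrite addmC; apply: upM.
Qed.

Lemma midealX (M : pred 'X_{1..N}) m : mideal M 'X_[m] = M m.
Proof. by rewrite /mideal msuppX /= andbT. Qed.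

(** The colon of a monomial ideal by a monomial is obtained by shifting the
predicate on exponents. *)
Lemma midealMX (M : pred 'X_{1..N}) g p :
  mideal M (p * 'X_[g]) = mideal (fun m => M (m + g)%MM) p.
Proof.
rewrite /mideal (perm_all _ (msuppMX p g)) all_map.
by apply: eq_all => m; rewrite /= addmC.
Qed.

Lemma eq_mideal (M M' : pred 'X_{1..N}) : M =1 M' -> mideal M =1 mideal M'.
Proof. by move=> eqM p; apply: eq_all. Qed.

Lemma mideal_sub (M M' : pred 'X_{1..N}) p :
  (forall m, M m -> M' m) -> mideal M p -> mideal M' p.
Proof. by move=> sub; apply: sub_all. Qed.

(** Reduces inclusions of a monomial ideal in another ideal to monomials. *)
Lemma mideal_ideal (M : pred 'X_{1..N}) A p : is_ideal A -> (forall m, M m -> A 'X_[m]) ->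
  mideal M p -> A p.
Proof.
move=> idA AM /allP Mp; rewrite [p]mpolyE big_seq_cond.
apply: (ideal_sum idA) => m /andP[/Mp Mm _].
by rewrite -mul_mpolyC; exact/(idealMl idA)/AM.
Qed.

Lemma in_ideal_monomials (ms : seq 'X_{1..N}) p :
  in_ideal [seq 'X_[g] | g <- ms] p
  <-> mideal (fun m => has (fun g => (g <= m)%MM) ms) p.
Proof.
split.
  apply: (@in_ideal_min (mideal _)).
    apply: ideal_mideal => m m' /hasP[g gms le]; apply/hasP; exists g => //.
    exact: lepm_trans le (lem_addr _ _).
  by move=> _ /mapP[g gms ->]; rewrite midealX; apply/hasP; exists g => //; apply: lepm_refl.
apply: (@mideal_ideal _ (in_ideal _)) => [|m /hasP[g gms /submK <-]]; first exact: ideal_in_ideal.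
rewrite mpolyXD; apply: (idealMl (ideal_in_ideal _)).
by apply/mem_in_ideal/map_f.
Qed.

Lemma lem_pair (u v : 'I_N) (m : 'X_{1..N}) : u != v ->
  (U_(u) + U_(v) <= m)%MM = (0 < m u)%N && (0 < m v)%N.
Proof.
move=> neq; apply/mnm_lepP/andP => [H | [mu mv] i].
  have := (H u, H v); rewrite !mnmDE !mnm1E !eqxx eq_sym (negPf neq).
  by rewrite addn0 add0n => -[].
rewrite mnmDE !mnm1E; case: eqP => [<-|_]; last by case: eqP => [<-|].
by rewrite eq_sym (negPf neq) addn0.
Qed.

End Ideals.

(** * Chains of ideals and algebraic independence *)

Section Towers.
Local Open Scope ring_scope.
Variables (k : fieldType) (N : nat).
Notation S := {mpoly k[N]}.
Implicit Types (A : S -> Prop) (fs : seq S) (f p q x y : S).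

Lemma mcoeff_scale (c : k) p m : (c *: p)@_m = c * p@_m.
Proof. exact: mcoeffZ. Qed.

Lemma mcoeff_sum I (r : seq I) (P : pred I) (F : I -> S) m :
  (\sum_(i <- r | P i) F i)@_m = \sum_(i <- r | P i) (F i)@_m.
Proof. exact: (big_morph _ (mcoeffD m) (mcoeff0 _ m)). Qed.

(** A chain of proper ideals, given by its first member [A] and by elements
[f] such that [f] lies in the next ideal and is a nonzerodivisor modulo the
current one. Both chains of primes and regular sequences give such towers, and
the number of elements [f] is bounded by the same dimension argument. *)
Inductive tower : (S -> Prop) -> seq S -> Prop :=
| TowerNil A : is_ideal A -> ~ A 1 -> tower A [::]
| TowerCons A A' f fs :
    is_ideal A -> (forall x, A (f * x) -> A x) -> (forall x, A x -> A' x) ->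
    A' f -> tower A' fs -> tower A (f :: fs).

(** The digits of [a] in base [T] are the exponents of a monomial in [fs], so
that a < T ^ size fs enumerates the monomials with all exponents below [T]. *)
Fixpoint digit_monomial (T : nat) fs (a : nat) : S :=
  if fs is f :: fs' then f ^+ (a %% T) * digit_monomial T fs' (a %/ T) else 1.

Lemma sum_digits (T n : nat) (F : nat -> S) :
  \sum_(a < T * n) F a = \sum_(r < T) \sum_(b < n) F (r + T * b)%N.
Proof.
elim: n => [|n IHn].
  by rewrite muln0 big_ord0 big1 // => r _; rewrite big_ord0.
rewrite mulnSr big_split_ord /= IHn -big_split /=; apply: eq_bigr => r _.
by rewrite big_ord_recr /= addnC.
Qed.

(** A polynomial in [f] lying in [A] has its constant coefficient in [A'],
since [f] is in [A']; if this forces that coefficient to vanish, then [f] can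
be cancelled and the argument goes on with the next coefficient. The predicate
[D] carries the form in which the vanishing is known. *)
Lemma tower_peel A A' f (D : nat -> Prop) (P : nat -> S) n :
  is_ideal A -> is_ideal A' ->
  (forall x, A (f * x) -> A x) -> (forall x, A x -> A' x) -> A' f ->
  (forall i, A' (P i) -> D i) -> (forall i, D i -> P i = 0) ->
  A (\sum_(i < n) f ^+ i * P i) -> forall i, (i < n)%N -> D i.
Proof.
move=> idA idA' Af AA' A'f; elim: n P D => // n IHn P D A'D DP.
rewrite big_ord_recl /= expr0 mul1r.
have ->: \sum_(i < n) f ^+ bump 0 i * P (bump 0 i)
       = f * \sum_(i < n) f ^+ i * P i.+1.
  by rewrite mulr_sumr; apply: eq_bigr => i _; rewrite exprS mulrA.
move=> Asum; have D0 : D 0%N.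
  apply/A'D/(idealDr idA' (P 0%N) (idealMr idA' _ A'f))/AA'.
  exact: Asum.
move: Asum; rewrite DP // add0r => /Af Asum [|i] // lti.
by apply: (IHn (fun i => P i.+1) (fun i => D i.+1)) lti => // j; [apply: A'D | apply: DP].
Qed.

(** The elements of a tower are algebraically independent modulo its first
ideal: modulo the second ideal the first element vanishes, and [tower_peel]
reduces the claim to the rest of the tower. *)
Lemma tower_independent T A fs (c : nat -> k) : tower A fs ->
  A (\sum_(a < T ^ size fs) c a *: digit_monomial T fs a) ->
  forall a, (a < T ^ size fs)%N -> c a = 0.
Proof.
move=> tow; elim: tow c => {A fs} [A idA A1 | A A' f fs idA Af AA' A'f tow IH] c /=.
  rewrite expn0 big_ord1 => Ac [|//] _; apply/eqP/negPn/negP => c0; apply: A1.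
  by have /(_ _ Ac) := idealMl idA (c 0%N)^-1%:MP; rewrite mul_mpolyC scalerA mulVf // scale1r.
have idA' : is_ideal A' by case: tow.
have [-> | T0] := posnP T; first by rewrite expnS.
rewrite expnS (sum_digits T _ (fun a => c a *: digit_monomial T (f :: fs) a)) /=.
set P := fun r => \sum_(b < T ^ size fs) c (r + T * b)%N *: digit_monomial T fs b.
rewrite (eq_bigr (fun r : 'I_T => f ^+ r * P r)); last first.
  move=> r _; rewrite mulr_sumr; apply: eq_bigr => b _.
  rewrite addnC mulnC modnMDl divnMDl // (modn_small (ltn_ord r)).
  by rewrite (divn_small (ltn_ord r)) addn0 scalerAr.
move=> /(tower_peel (D := fun r => forall b, (b < T ^ size fs)%N -> c (r + T * b)%N = 0)
   idA idA' Af AA' A'f) H a lta.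
rewrite (divn_eq a T) addnC mulnC; apply: H.
- by move=> r; apply: IH.
- by move=> r c0; rewrite /P big1 // => b _; rewrite c0 ?scale0r.
- exact: ltn_pmod.
- by rewrite ltn_divLR // mulnC.
Qed.

Definition degree_le (b : nat) p : Prop := forall m, p@_m != 0 -> (mdeg m <= b)%N.

Lemma degree_leM a b p q :
  degree_le a p -> degree_le b q -> degree_le (a + b) (p * q).
Proof.
move=> pa qb m /mcoeffM_neq0[m1 [m2 [-> /pa le1 /qb le2]]].
by rewrite mdegD leq_add.
Qed.

Lemma degree_leW a b p : (a <= b)%N -> degree_le a p -> degree_le b p.
Proof. by move=> le pa m /pa/leq_trans; apply. Qed.

Lemma degree_le1 : degree_le 0 1.
Proof. by move=> m; rewrite mcoeff1; have [->|] := eqVneq m 0%MM; rewrite ?mdeg0 ?eqxx. Qed.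

Lemma degree_le_digit_monomial T fs e a : (0 < T)%N ->
  {in fs, forall f, degree_le e f} ->
  degree_le (size fs * (T * e)) (digit_monomial T fs a).
Proof.
move=> T0; elim: fs a => [|f fs IH] a fse; first exact: degree_le1.
rewrite /= mulSn; apply: degree_leM; last first.
  by apply: IH => g gfs; apply: fse; rewrite inE gfs orbT.
apply: (@degree_leW ((a %% T) * e)); first by rewrite leq_mul2r ltnW ?orbT ?ltn_pmod.
elim: (a %% T)%N => [|n IHn]; first exact: degree_le1.
rewrite exprS mulSn; apply: degree_leM => //.
exact/fse/mem_head.
Qed.

(** The monomials that involve a variable of [Z]; they span the prime ideal
generated by these variables. *)
Definition meets (Z : {set 'I_N}) (m : 'X_{1..N}) : bool :=
  [exists z in Z, (0 < m z)%N].

Lemma upclosed_meets Z : upclosed (meets Z).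
Proof.
move=> m m' /exists_inP[z zZ mz]; apply/exists_inP; exists z => //.
by rewrite mnmDE addn_gt0 mz.
Qed.

(** Transcendence degree by counting. Modulo the variables in [Z] there are at
most B ^ q monomials of degree below B, where q is the number of remaining
variables, and B is linear in [T]. If [fs] has more than q elements, then the
T ^ size fs monomials in [fs] outnumber them for large [T]. *)
Lemma digit_monomials_dependent (Z : {set 'I_N}) fs : (#|~: Z| < size fs)%N ->
  exists T (c : nat -> k), (exists2 a, (a < T ^ size fs)%N & c a != 0) /\
    mideal (meets Z) (\sum_(a < T ^ size fs) c a *: digit_monomial T fs a).
Proof.
set d := size fs; set q := #|~: Z| => ltqd.
pose e := (\max_(f <- fs) msize f)%N.
have fse : {in fs, forall f, degree_le e f}.
  move=> f ffs m; rewrite -mcoeff_msupp => /msize_mdeg_lt/ltnW/leq_trans; apply.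
  by rewrite /e (big_rem f) //= leq_maxl.
(* All monomials in fs with exponents below T have degree below B, and
   B <= T (1 + d e), so that B ^ q < T ^ q.+1. *)
pose T := ((1 + d * e) ^ q).+1; pose B := (d * (T * e)).+1.
have ltBT : (B ^ q < T ^ d)%N.
  have leB : (B <= T * (1 + d * e))%N by rewrite /B /T; nia.
  apply: leq_ltn_trans (_ : (T ^ q * (1 + d * e) ^ q < _)%N).
    by rewrite -expnMn; case: (q) => // q'; rewrite leq_exp2r.
  apply: (@leq_trans (T ^ q.+1)); last by rewrite leq_pexp2l.
  by rewrite expnSr ltn_pmul2l // expn_gt0.
pose I := {ffun {z : 'I_N | z \in ~: Z} -> 'I_B}.
have cardI : #|{: I}| = (B ^ q)%N.
  by rewrite card_ffun card_ord card_sig; congr (_ ^ _)%N; apply: eq_card.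
pose mon (t : I) : 'X_{1..N} :=
  [multinom (if insub i is Some z then t z : nat else 0%N) | i < N].
pose M := \matrix_(a < T ^ d, b < #|{: I}|)
  (digit_monomial T fs a)@_(mon (enum_val b)).
have kerM : kermx M != 0.
  rewrite -mxrank_eq0 mxrank_ker -lt0n subn_gt0.
  by apply: leq_ltn_trans (rank_leq_col M) _; rewrite cardI.
have [i kerMi] := rowV0Pn kerM.
have {kerMi}[/sub_kermxP vM v0] := (kerMi).
exists T, (fun a => if insub a is Some j then i 0 j else 0); split.
  have /rV0Pn[j vj] := v0; exists j => //.
  by rewrite valK.
rewrite (eq_bigr (fun a : 'I_(T ^ d) => i 0 a *: digit_monomial T fs a)); last first.
  by move=> a _; rewrite valK.
apply/midealP => m; apply: contraR => mZ.
have [ltm | gem] := ltnP (mdeg m) B; last first.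
  rewrite mcoeff_sum big1 // => a _; rewrite mcoeff_scale.
  have [->|nz] := eqVneq ((digit_monomial T fs a)@_m) 0; first by rewrite mulr0.
  have := degree_le_digit_monomial (ltn0Sn _) fse nz.
  by rewrite leqNgt gem.
have ltmi j : (m j < B)%N.
  by apply: leq_ltn_trans ltm; rewrite mdegE (bigD1 j) //= leq_addr.
pose t : I := [ffun z => Ordinal (ltmi (val z))].
have mt : mon t = m.
  apply/mnmP => j; rewrite mnmE; case: insubP => [z _ <- | ]; first by rewrite ffunE.
  rewrite inE negbK => jZ; apply/esym/eqP; rewrite -leqn0 leqNgt.
  by apply: contra mZ => mj; apply/exists_inP; exists j.
have vMt : (i *m M) 0 (enum_rank t) = 0 by rewrite vM mxE.
move: vMt; rewrite mxE mcoeff_sum => vMt; apply/eqP; rewrite -[RHS]vMt.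
by apply: eq_bigr => a _; rewrite mcoeff_scale [X in _ = _ * X]mxE enum_rankK mt.
Qed.

(** Dimension bound for towers, used for the Krull dimension and for the
depth. *)
Theorem tower_size (Z : {set 'I_N}) A fs : tower A fs ->
  {in Z, forall z, A 'X_z} -> (size fs <= #|~: Z|)%N.
Proof.
move=> tow AZ; rewrite leqNgt; apply/negP => /digit_monomials_dependent.
case=> T [c [[a lta /eqP ca0] Zc]]; apply: ca0.
have idA : is_ideal A by case: tow.
apply: (tower_independent tow) lta.
apply: (mideal_ideal idA _ Zc) => m /exists_inP[z zZ mz].
have ->: m = (m - U_(z) + U_(z))%MM.
  by rewrite submK //; apply/mnm_lepP => j; rewrite mnm1E; case: eqP => // <-.
by rewrite mpolyXD; apply: (idealMl idA); apply: AZ.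
Qed.

End Towers.

(** * Regular sequences, prime chains and variable ideals *)

Section Depth.
Local Open Scope ring_scope.
Variables (k : fieldType) (N : nat).
Notation S := {mpoly k[N]}.
Implicit Types (A : S -> Prop) (gs fs : seq S) (f p q u x y : S).

Definition homogeneous_seq gs : Prop :=
  forall g, g \in gs -> exists d, g \is d.-homog.

Lemma pihomogMr d e c f : f \is e.-homog ->
  pihomog mdeg d (c * f)
  = (if (e <= d)%N then pihomog mdeg (d - e) c else 0) * f.
Proof.
move=> fe; rewrite [c]mpolyE mulr_suml !raddf_sum /=.
have -> : (if (e <= d)%N then
      \sum_(m <- msupp c) pihomog mdeg (d - e) (c@_m *: 'X_[m]) else 0)
    = \sum_(m <- msupp c) (if (e <= d)%N then
        pihomog mdeg (d - e) (c@_m *: 'X_[m]) else 0).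
  by case: ifP => // _; rewrite big1.
rewrite mulr_suml; apply: eq_bigr => m _.
have Xf : 'X_[m] * f \is (mdeg m + e).-homog by apply: dhomogM; rewrite // dhomogX.
rewrite -scalerAl !linearZ /= pihomogX.
have [eqd | ned] := eqVneq (mdeg m + e)%N d.
  rewrite -{1}eqd pihomog_dE // -eqd leq_addl addnK eqxx.
  by rewrite scalerAl.
rewrite (pihomog_ne0 ned Xf) scaler0; case: leqP => [led|]; last by rewrite mul0r.
by rewrite (negPf (_ : mdeg m != d - e)%N) ?scaler0 ?mul0r //; apply: contra ned; lia.
Qed.

Lemma pihomog_in_ideal gs d p : homogeneous_seq gs ->
  in_ideal gs p -> in_ideal gs (pihomog mdeg d p).
Proof.
move=> homgs [c ->]; rewrite raddf_sum; apply: (ideal_sum (ideal_in_ideal gs)) => i _.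
have gi := mem_nth 0 (ltn_ord i); have [e ge] := homgs _ gi.
rewrite /= (pihomogMr _ _ ge); apply: (idealMl (ideal_in_ideal gs)).
exact: mem_in_ideal.
Qed.

(** The graded case of Krull's intersection theorem: in degree below [n * d],
a multiple of [f ^+ n] has no component. *)
Lemma homogeneous_separated gs f d u : homogeneous_seq gs ->
  (0 < d)%N -> f \is d.-homog ->
  (forall n, exists q, in_ideal gs (u - f ^+ n * q)) -> in_ideal gs u.
Proof.
move=> homgs d0 fd /(_ (msize u))[q uq].
rewrite (pihomog_partitionE (leqnn (msize u))).
apply: (ideal_sum (ideal_in_ideal gs)) => i _.
have := pihomog_in_ideal i homgs uq.
have fn : f ^+ msize u \is (d * msize u)%N.-homog by apply: dhomogMn.
rewrite raddfB /= [f ^+ _ * q]mulrC (pihomogMr _ _ fn).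
rewrite leqNgt (_ : i < d * msize u)%N /= ?mul0r ?subr0 //.
by apply: leq_trans (ltn_ord i) _; rewrite leq_pmull.
Qed.

Lemma regular_sequence_cons gs f fs : regular_sequence gs (f :: fs) ->
  (forall p, in_ideal gs (f * p) -> in_ideal gs p)
  /\ regular_sequence (rcons gs f) fs.
Proof.
case=> prop reg; split=> [p |].
  by have := reg 0%N isT p; rewrite take0 cats0.
split; first by rewrite cat_rcons.
by move=> i lti p; have := reg i.+1 lti p; rewrite /= cat_rcons.
Qed.

(** The ideals of the tower are the annihilators of elements u_0 = u, u_1, ...,
where u_i is nonzero modulo the first i elements of [fs]. Dividing u_i by the
next element as often as possible gives u_(i+1); this stops by
[homogeneous_separated], and division does not change the annihilator because
the element is regular. *)
Lemma regular_tower gs fs u : homogeneous_seq gs -> homog_pos_degree fs ->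
  regular_sequence gs fs -> ~ in_ideal gs u ->
  tower (fun x => in_ideal gs (x * u)) fs.
Proof.
have idA gs' w : is_ideal (fun x : S => in_ideal gs' (x * w)).
  split; first by rewrite mul0r; exact: (ideal0 (ideal_in_ideal _)).
  by move=> a x y ? ?; rewrite mulrDl -mulrA; apply: (ideal_in_ideal gs').2.
elim: fs gs u => [|f fs IH] gs u homgs homfs reg nu.
  by constructor; rewrite ?mul1r.
have [regf regfs] := regular_sequence_cons reg.
have [d d0 fd] := homfs f (mem_head _ _).
have [n [v [uv nv]]] : exists n v,
    in_ideal gs (u - f ^+ n * v) /\ ~ in_ideal (rcons gs f) v.
  apply: NNPP => noex; apply: nu; apply: (homogeneous_separated homgs d0 fd) => n.
  elim: n => [|n [v uv]].
    by exists u; rewrite mul1r subrr; exact: (ideal0 (ideal_in_ideal _)).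
  have /in_ideal_rcons[q vq] : in_ideal (rcons gs f) v.
    by apply: NNPP => nv; apply: noex; exists n, v.
  exists q; have -> : u - f ^+ n.+1 * q
      = f ^+ n * (v - q * f) + (u - f ^+ n * v) by rewrite exprS; ring.
  exact: (ideal_in_ideal gs).2.
have regfn p : in_ideal gs (f ^+ n * p) -> in_ideal gs p.
  elim: (n) => [|j IHj]; first by rewrite mul1r.
  by rewrite exprS -mulrA => /regf.
apply: (TowerCons (A' := fun x => in_ideal (rcons gs f) (x * v))) => //.
- by move=> x; rewrite -mulrA => /regf.
- move=> x xu; have : in_ideal gs (x * v).
    apply: regfn; rewrite mulrCA -[x * _](subKr (x * u)) -mulrBr.
    by apply: (idealB (ideal_in_ideal gs)) => //; apply: (idealMl (ideal_in_ideal gs)).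
  by apply: in_ideal_sub => g ggs; rewrite mem_rcons inE ggs orbT.
- apply: (idealMr (ideal_in_ideal _)); apply: mem_in_ideal.
  by rewrite mem_rcons mem_head.
- apply: IH => // g; last by move=> gfs; apply: homfs; rewrite inE gfs orbT.
  by rewrite mem_rcons inE => /orP[/eqP->|/homgs //]; exists d.
Qed.

(** Depth is at most the dimension of S / P for a prime P generated by
variables that annihilates a nonzero element. *)
Theorem regular_sequence_size gs fs u (Z : {set 'I_N}) :
  homogeneous_seq gs -> homog_pos_degree fs -> regular_sequence gs fs ->
  ~ in_ideal gs u -> {in Z, forall z, in_ideal gs ('X_z * u)} ->
  (size fs <= #|~: Z|)%N.
Proof.
move=> homgs homfs reg nu XZ.
exact: tower_size (regular_tower homgs homfs reg nu) XZ.
Qed.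

(** Any element of a prime of the chain outside the previous prime is a
nonzerodivisor modulo the latter. *)
Lemma prime_chain_tower gs d (P : nat -> {pred S}) : prime_chain gs d P ->
  exists2 fs, size fs = d & tower (fun x => x \in P 0%N) fs.
Proof.
elim: d P => [|d IH] P [prP ltP].
  exists [::] => //; have [[P0 P1 PD] _ _] := prP 0%N isT.
  constructor; last exact/negP.
  by split=> // a x y; apply: PD.
have [] := IH (fun i => P i.+1).
  by split=> [i lei | i lti]; [apply: prP | apply: ltP].
move=> fs sfs tow; have [[P0 P1 PD] prime0 _] := prP 0%N isT.
have [sub [f fP1 fP0]] := ltP 0%N isT.
exists (f :: fs); first by rewrite /= sfs.
apply: (TowerCons (A' := fun x => x \in P 1%N)) => //.
- by move=> x /prime0/orP[] //; rewrite (negPf fP0).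
Qed.

(** Substituting 0 for the variables in [Z]: its kernel is the ideal they
generate, which is therefore prime. *)
Definition kill (Z : {set 'I_N}) p : S :=
  p \mPo [tuple (if i \in Z then 0 else 'X_i) | i < N].

Lemma killX Z m : kill Z 'X_[m] = if meets Z m then 0 else 'X_[m].
Proof.
rewrite /kill comp_mpolyX; case: ifP => [/exists_inP[z zZ mz] | Zm].
  by rewrite (bigD1 z) //= tnth_mktuple zZ expr0n eqn0Ngt mz mul0r.
rewrite [RHS]mpolyXE_id; apply: eq_bigr => i _; rewrite tnth_mktuple.
case: ifP => // iZ; suff -> : m i = 0%N by [].
apply/eqP; rewrite -leqn0 leqNgt; apply: contraFN Zm => mi.
by apply/exists_inP; exists i.
Qed.

Lemma mideal_meetsE Z p : mideal (meets Z) p = (kill Z p == 0).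
Proof.
apply/idP/eqP => [|kp0].
  apply: (@mideal_ideal _ _ _ (fun p => kill Z p = 0)) => [|m mZ].
    split=> [|a x y x0 y0]; first exact: comp_mpoly0.
    by move: x0 y0; rewrite /kill rmorphD rmorphM /= => -> ->; rewrite mulr0 addr0.
  by rewrite killX mZ.
rewrite -[p]subr0 -kp0; clear.
have idZ := ideal_mideal k (@upclosed_meets N Z).
have -> : p - kill Z p = \sum_(m <- msupp p) (p@_m)%:MP * ('X_[m] - kill Z 'X_[m]).
  under eq_bigr do rewrite mulrBr; rewrite sumrB; congr (_ - _).
    by rewrite [LHS]mpolyE; apply: eq_bigr => m _; rewrite mul_mpolyC.
  rewrite {1}[p]mpolyE /kill (big_morph _ (comp_mpolyD _) (comp_mpoly0 _)).
  by apply: eq_bigr => m _; rewrite comp_mpolyZ mul_mpolyC.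
apply: (ideal_sum idZ) => m _; apply: (idealMl idZ).
rewrite killX; case: ifP => [mZ|_]; last by rewrite subrr; exact: (ideal0 idZ).
by rewrite subr0 midealX.
Qed.

Lemma prime_mideal_meets Z : idealr_closed (mideal (meets Z) : {pred S})
   /\ prime_idealr_closed (mideal (meets Z) : {pred S}).
Proof.
have idZ := ideal_mideal k (@upclosed_meets N Z).
have memE p : (p \in (mideal (meets Z) : {pred S})) = (kill Z p == 0).
  exact: mideal_meetsE.
split; last by move=> x y; rewrite !memE /kill rmorphM mulf_eq0.
split; first exact: (ideal0 idZ).
  by rewrite memE /kill comp_mpoly1 oner_eq0.
by move=> a x y; apply: idZ.2.
Qed.

End Depth.

(** * Vertex covers and edge ideals *)

Section VertexCovers.
Variables (V : finType) (e : rel V).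
Hypotheses (symE : ssrbool.symmetric e) (irrE : irreflexive e).
Implicit Types C D : {set V}.

(** For a vertex cover, this is minimality with respect to inclusion, in the
form in which it is used. *)
Definition irredundant C : Prop :=
  forall c, c \in C -> exists2 w, w \notin C & e c w.

Lemma vertex_coverP C :
  reflect (forall u v, e u v -> (u \in C) || (v \in C)) (vertex_cover e C).
Proof.
apply: (iffP forallP) => [H u v uv | H u]; first by move/forallP: (H u) => /(_ v)/implyP; apply.
by apply/forallP => v; apply/implyP; apply: H.
Qed.

Lemma minset_irredundant C : minset (vertex_cover e) C ->
  vertex_cover e C /\ irredundant C.
Proof.
move=> /minsetP[covC minC]; split=> // c cC.
have [/exists_inP[w wC cw] | noex] := boolP [exists w in ~: C, e c w].
  by exists w => //; rewrite -in_setC.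
suff covD : vertex_cover e (C :\ c).
  by have /setP/(_ c) := minC _ covD (subD1set C c); rewrite !inE eqxx cC.
have only w : e c w -> w \in C.
  move=> cw; apply: contraR noex => wC; apply/exists_inP; exists w => //.
  by rewrite inE.
apply/vertex_coverP => u v uv; rewrite !inE.
have [uc | _] := eqVneq u c.
  rewrite uc in uv; rewrite (only v uv) andbT /=.
  by apply: contraTneq uv => ->; rewrite irrE.
have [vc | _] := eqVneq v c; last by apply: (vertex_coverP _ covC).
by rewrite vc symE in uv; rewrite (only u uv).
Qed.

Lemma irredundant_minset C : vertex_cover e C -> irredundant C ->
  minset (vertex_cover e) C.
Proof.
move=> covC irrC; apply/minsetP; split=> // D covD sDC.
apply/eqP; rewrite eqEsubset sDC; apply/subsetP => c /irrC[w wC cw].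
by case/orP: ((vertex_coverP _ covD) c w cw) => // /(subsetP sDC); rewrite (negPf wC).
Qed.

End VertexCovers.

Section EdgeIdeals.
Local Open Scope ring_scope.
Variables (k : fieldType) (V : finType) (e : rel V).
Hypothesis irrE : irreflexive e.
Notation N := #|V|.
Notation S := {mpoly k[N]}.
Notation I := (edge_ideal k e).
Implicit Types (C D : {set V}) (p q : S).

Definition edge_monomial (m : 'X_{1..N}) : bool :=
  [exists u, exists v,
    [&& e u v, 0 < m (enum_rank u) & 0 < m (enum_rank v)]%N].

Lemma edge_monomialP (m : 'X_{1..N}) :
  reflect (exists u v, [/\ e u v, 0 < m (enum_rank u) & 0 < m (enum_rank v)]%N)
          (edge_monomial m).
Proof.
apply: (iffP existsP) => [[u /existsP[v /and3P H]] | [u [v H]]]; exists u.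
  by exists v.
by apply/existsP; exists v; apply/and3P.
Qed.

Lemma in_edge_ideal p : in_ideal I p <-> mideal edge_monomial p.
Proof.
have -> : I = [seq 'X_[g] | g <- [seq (U_(enum_rank w.1) + U_(enum_rank w.2))%MM
     | w : V * V <- enum [pred w : V * V | e w.1 w.2]]].
  by rewrite -map_comp; apply: eq_map => w /=; rewrite mpolyXD.
rewrite in_ideal_monomials; suff eqM (m : 'X_{1..N}) : has (fun g => (g <= m)%MM)
    [seq (U_(enum_rank w.1) + U_(enum_rank w.2))%MM
      | w : V * V <- enum [pred w : V * V | e w.1 w.2]] = edge_monomial m.
  by rewrite (eq_mideal eqM).
have leU u v : e u v -> (U_(enum_rank u) + U_(enum_rank v) <= m)%MM
      = (0 < m (enum_rank u))%N && (0 < m (enum_rank v))%N.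
  move=> uv; apply: lem_pair.
  by apply: contraTneq uv => /enum_rank_inj ->; rewrite irrE.
apply/hasP/edge_monomialP => [[g /mapP[[u v]]]|[u [v [uv mu mv]]]].
  by rewrite mem_enum inE /= => uv ->; rewrite leU // => /andP[]; exists u, v.
exists (U_(enum_rank u) + U_(enum_rank v))%MM; last by rewrite leU // mu.
by apply/mapP; exists (u, v); rewrite ?mem_enum.
Qed.

Lemma edge_ideal_gens (g : S) : g \in I ->
  exists u v, e u v /\ g = 'X_(enum_rank u) * 'X_(enum_rank v).
Proof. by case/mapP=> [[u v]]; rewrite mem_enum inE /= => uv ->; exists u, v. Qed.

Lemma mem_edge_ideal u v : e u v -> 'X_(enum_rank u) * 'X_(enum_rank v) \in I.
Proof. by move=> uv; apply/mapP; exists (u, v); rewrite ?mem_enum. Qed.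

Lemma homogeneous_edge_ideal : homogeneous_seq I.
Proof.
move=> g /edge_ideal_gens[u [v [_ ->]]]; exists 2.
by rewrite -mpolyXD dhomogX /= mdegD !mdeg1.
Qed.

Definition cover_vars C : {set 'I_N} := enum_rank @: C.

Lemma mem_cover_vars C v : (enum_rank v \in cover_vars C) = (v \in C).
Proof. by rewrite mem_imset //; apply: enum_rank_inj. Qed.

Lemma card_cover_vars C : #|~: cover_vars C| = (#|V| - #|C|)%N.
Proof.
have := cardsC (cover_vars C); rewrite card_imset; last exact: enum_rank_inj.
by rewrite card_ord => cardV; rewrite -[X in (X - _)%N]cardV addKn.
Qed.

(** The element is the product of the variables outside [C]: it is not in the
ideal as the complement of [C] is independent, and each c in [C] has a
neighbour there. *)
Lemma irredundant_cover_socle C : vertex_cover e C -> irredundant e C ->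
  exists u : S, ~ in_ideal I u
    /\ {in cover_vars C, forall z, in_ideal I ('X_z * u)}.
Proof.
move=> /vertex_coverP covC irrC.
pose m : 'X_{1..N} := [multinom ((i \notin cover_vars C) : nat) | i < N].
exists 'X_[m]; split.
  move/in_edge_ideal; rewrite midealX => /edge_monomialP[u [v [uv]]].
  rewrite !mnmE !lt0b !mem_cover_vars => uC vC.
  by have := covC u v uv; rewrite (negPf uC) (negPf vC).
move=> _ /imsetP[c cC ->]; have [w wC cw] := irrC c cC.
apply/in_edge_ideal; rewrite -mpolyXD midealX; apply/edge_monomialP.
exists c, w; rewrite !mnmDE mnm1E eqxx; split=> //.
by rewrite [m _]mnmE mem_cover_vars wC addn1.
Qed.

Lemma edge_ideal_depth_le C fs : vertex_cover e C -> irredundant e C ->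
  homog_pos_degree fs -> regular_sequence I fs -> (size fs <= #|V| - #|C|)%N.
Proof.
move=> covC irrC homfs reg; rewrite -card_cover_vars.
have [u [nu Cu]] := irredundant_cover_socle covC irrC.
exact: (regular_sequence_size homogeneous_edge_ideal homfs reg nu).
Qed.

(** For the upper bound, the variables in the first prime of a chain form a
vertex cover. For the lower bound, start with the variables of [C] and add
the others one at a time. *)
Lemma edge_ideal_krull_dim C : vertex_cover e C ->
  (forall D, vertex_cover e D -> #|C| <= #|D|)%N ->
  has_krull_dim I (#|V| - #|C|).
Proof.
move=> /vertex_coverP covC minC; split; last first.
  move=> d' P chP; have [fs <- tow] := prime_chain_tower chP.
  have [_ prime0 sub0] := chP.1 0%N isT.
  pose D := [set v | 'X_(enum_rank v) \in P 0%N].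
  apply: leq_trans (tower_size (Z := cover_vars D) tow _) _.
    by move=> _ /imsetP[v + ->]; rewrite inE.
  rewrite card_cover_vars leq_sub2l // minC //; apply/vertex_coverP => u v uv.
  by rewrite !inE; apply/prime0/sub0/mem_edge_ideal.
pose s := enum (~: cover_vars C).
have szs : size s = (#|V| - #|C|)%N by rewrite -card_cover_vars cardE.
pose Z i := cover_vars C :|: [set z in take i s].
have PX i (m : 'X_{1..N}) :
    ('X_[m] \in (mideal (meets (Z i)) : {pred S})) = meets (Z i) m.
  exact: midealX.
exists (fun i => mideal (meets (Z i)) : {pred S}); rewrite -szs; split=> [i lei | i lti].
  have [] := prime_mideal_meets k (Z i); split=> // g /edge_ideal_gens[u [v [uv ->]]].
  rewrite -mpolyXD PX; apply/exists_inP.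
  case/orP: (covC u v uv) => inC; [exists (enum_rank u) | exists (enum_rank v)];
    by rewrite ?mnmDE ?mnm1E ?eqxx ?addn1 // inE mem_cover_vars inC.
split.
  move=> p; apply: mideal_sub => m /exists_inP[z zZ mz]; apply/exists_inP; exists z => //.
  move: zZ; rewrite !inE => /orP[-> // | zs]; rewrite (take_nth z) // mem_rcons inE zs.
  by rewrite !orbT.
have [z0 _] : exists z : 'I_N, z \in s.
  by move: lti; case: (s) => [|z s'] // _; exists z; apply: mem_head.
have zs := mem_nth z0 lti; set z := nth z0 s i in zs.
exists 'X_z.
  rewrite PX; apply/exists_inP; exists z; last by rewrite mnm1E eqxx.
  by rewrite !inE (take_nth z0) // mem_rcons mem_head orbT.
rewrite PX; apply/exists_inP => [[z' zZ]]; rewrite mnm1E lt0b => /eqP eqz.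
move: zZ; rewrite -{}eqz !inE => /orP[zC | zt].
  by move: zs; rewrite mem_enum inE zC.
have := enum_uniq (~: cover_vars C); rewrite -/s -(cat_take_drop i s) cat_uniq.
case/and3P=> _ /hasPn dropN _; suff /dropN : z \in drop i s by rewrite /= zt.
by rewrite (drop_nth z0) // mem_head.
Qed.

End EdgeIdeals.

(** * A lower bound for the length of a free resolution *)

Section ProjectiveDimension.
Local Open Scope ring_scope.
Variables (k : fieldType) (N : nat).
Notation S := {mpoly k[N]}.
Implicit Types (J gs xs : seq S).

Definition in_idealv J n (v : 'rV[S]_n) : Prop := forall j, in_ideal J (v 0 j).

Lemma in_idealv_lin J n a (v w : 'rV[S]_n) :
  in_idealv J v -> in_idealv J w -> in_idealv J (a *: v + w).
Proof. by move=> Jv Jw j; rewrite !mxE; apply: (ideal_in_ideal J).2. Qed.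

Lemma in_idealv0 J n : in_idealv J (0 : 'rV[S]_n).
Proof. by move=> j; rewrite mxE; exact: (ideal0 (ideal_in_ideal _)). Qed.

Lemma in_idealvD J n (v w : 'rV[S]_n) :
  in_idealv J v -> in_idealv J w -> in_idealv J (v + w).
Proof. by move=> Jv Jw; rewrite -[v]scale1r; apply: in_idealv_lin. Qed.

Lemma in_idealvZ J n a (v : 'rV[S]_n) : in_idealv J v -> in_idealv J (a *: v).
Proof. by rewrite -[_ *: _]addr0 => Jv; apply: in_idealv_lin (@in_idealv0 J n). Qed.

Lemma in_idealvB J n (v w : 'rV[S]_n) :
  in_idealv J v -> in_idealv J w -> in_idealv J (v - w).
Proof. by move=> Jv /(in_idealvZ (-1)); rewrite scaleN1r; apply: in_idealvD. Qed.

Lemma in_idealvM J n n' (v : 'rV[S]_n) (D : 'M[S]_(n, n')) :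
  in_idealv J v -> in_idealv J (v *m D).
Proof.
move=> Jv j; rewrite mxE; apply: (ideal_sum (ideal_in_ideal J)) => i _.
exact: (idealMr (ideal_in_ideal J)).
Qed.

Lemma in_idealv_nil n (v : 'rV[S]_n) : in_idealv [::] v <-> v = 0.
Proof.
split=> [v0 | ->]; last exact: in_idealv0.
by apply/rowP => j; rewrite mxE; apply/in_ideal_nil.
Qed.

Lemma in_idealv_rcons J x n (v : 'rV[S]_n) :
  in_idealv (rcons J x) v <-> exists t, in_idealv J (v - x *: t).
Proof.
split=> [Jv | [t Jt] j]; last first.
  by apply/in_ideal_rcons; exists (t 0 j); have := Jt j; rewrite !mxE mulrC.
have Jvj j : exists q, in_ideal J (v 0 j - q * x) by apply/in_ideal_rcons.
have [t Jt] := fin_all_exists Jvj.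
by exists (\row_j t j) => j; rewrite !mxE mulrC.
Qed.

Section Resolution.
Variables (gs : seq S) (F : graded_free_seq k N).
Hypothesis resF : minimal_graded_free_resolution gs F.
Variable xs : seq S.
Hypothesis regular_xs : regular_sequence [::] xs.
Notation J i := (take i xs).
Notation d := (gf_d F).

Lemma in_idealv_take i n (v : 'rV[S]_n) : (i < size xs)%N ->
  in_idealv (J i.+1) v <-> exists t, in_idealv (J i) (v - xs`_i *: t).
Proof. by move=> lti; rewrite (take_nth 0) // in_idealv_rcons. Qed.

Lemma in_idealv_regular i n (v : 'rV[S]_n) : (i < size xs)%N ->
  in_idealv (J i) (xs`_i *: v) -> in_idealv (J i) v.
Proof.
move=> lti Jv j; apply: (regular_xs.2 i lti (v 0 j)).
by have := Jv j; rewrite mxE.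
Qed.

Lemma gf_d_comp i n (v : 'M[S]_(n, _)) : v *m d i.+1 *m d i = 0.
Proof.
apply/row_matrixP => a; rewrite row0 !row_mul.
by apply/(gf_exact resF); exists (row a v).
Qed.

(** The vanishing of Tor_j(S / gs, S / (x_1, ..., x_i)) for j > i, by induction
on i: a cycle modulo x_1, ..., x_(i+1) maps to x_(i+1) t modulo the first i
elements; cancelling x_(i+1) shows that t is a cycle one step further down,
hence a boundary, and subtracting a multiple of x_(i+1) gives a cycle modulo
x_1, ..., x_i. *)
Lemma exact_mod_regular i j (v : 'rV[S]_(gf_rank F j.+1)) :
  (i <= size xs)%N -> (i <= j)%N ->
  in_idealv (J i) (v *m d j) ->
  exists w, in_idealv (J i) (v - w *m d j.+1).
Proof.
elim: i j v => [|i IH] j v lti leij.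
  rewrite take0 => /in_idealv_nil/(gf_exact resF)[w ->].
  by exists w; rewrite subrr; apply: in_idealv0.
case: j leij v => // j leij v /(in_idealv_take _ lti)[t Jt].
have Jtd : in_idealv (J i) (t *m d j).
  apply: (in_idealv_regular lti).
  have := in_idealvM (d j) Jt; rewrite mulmxBl gf_d_comp sub0r -scalemxAl.
  by move/(in_idealvZ (-1)); rewrite scaleN1r opprK.
have [s Js] := IH j t (ltnW lti) leij Jtd.
have [|w Jw] := IH j.+1 (v - xs`_i *: s) (ltnW lti) (leqW leij).
  rewrite mulmxBl -scalemxAl.
  have -> : v *m d j.+1 - xs`_i *: (s *m d j.+1)
      = xs`_i *: (t - s *m d j.+1) + (v *m d j.+1 - xs`_i *: t).
    by move: (v *m _) (s *m _) => a b; apply/rowP => c; rewrite !mxE; ring.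
  exact: in_idealv_lin.
exists w; apply/in_idealv_take => //; exists s.
by rewrite addrAC.
Qed.

(** The element [w] of degree i is not a boundary modulo x_1, ..., x_i but
becomes one after multiplication by each member of [xs]. To pass to i + 1, let
[v] be such that x_(i+1) w is the boundary of [v]. *)
Lemma socle_mod_regular u i : ~ in_ideal gs u ->
  {in xs, forall x, in_ideal gs (x * u)} -> (i <= size xs)%N ->
  exists w : 'rV[S]_(gf_rank F i),
    ~ (exists s, in_idealv (J i) (w - s *m d i))
    /\ {in xs, forall x, exists s, in_idealv (J i) (x *: w - s *m d i)}.
Proof.
move=> nu xu; elim: i => [|i IH] lti.
  have [v v1] := gf_aug_surj resF.
  have augE p : in_ideal gs (((p *: v) *m gf_aug F) 0 0) <-> in_ideal gs p.
    rewrite -scalemxAl mxE -[X in X <-> _](idealDr (ideal_in_ideal gs)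
      _ (idealMl (ideal_in_ideal gs) (- p) v1)).
    by have -> : forall a, p * a + - p * (a - 1) = p by move=> a; ring.
  exists (u *: v); rewrite take0; split.
    case=> s /in_idealv_nil/eqP; rewrite subr_eq0 => /eqP us.
    by apply/nu/augE/(gf_exact0 resF); exists s.
  move=> x xxs; have /augE/(gf_exact0 resF)[s xus] := xu x xxs.
  by exists s; rewrite scalerA xus subrr; apply: in_idealv0.
have [w [nw xw]] := IH (ltnW lti); have xixs := mem_nth 0 lti.
have [v Jv] := xw _ xixs.
exists v; split=> [[s /(in_idealv_take _ lti)[t Jt]] | x xxs].
  apply: nw; exists t; apply: (in_idealv_regular lti).
  have := in_idealvD Jv (in_idealvM (d i) Jt).
  rewrite !mulmxBl gf_d_comp subr0 -scalemxAl addrA subrK.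
  by rewrite scalerBr.
have [s Js] := xw x xxs.
have [|r Jr] := @exact_mod_regular i i (x *: v - xs`_i *: s) (ltnW lti) (leqnn i).
  rewrite mulmxBl -!scalemxAl.
  have -> : x *: (v *m d i) - xs`_i *: (s *m d i)
     = xs`_i *: (x *: w - s *m d i) - x *: (xs`_i *: w - v *m d i).
    by move: (v *m _) (s *m _) => a b; apply/rowP => c; rewrite !mxE; ring.
  by apply: in_idealvB; apply: in_idealvZ.
exists r; apply/in_idealv_take => //; exists s.
by rewrite addrAC.
Qed.

(** The projective dimension of S / gs is at least the length of any regular
sequence of S that annihilates a nonzero element. *)
Theorem resolution_length u : ~ in_ideal gs u ->
  {in xs, forall x, in_ideal gs (x * u)} -> (0 < gf_rank F (size xs))%N.
Proof.
move=> nu xu; have [w [nw _]] := socle_mod_regular nu xu (leqnn _).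
rewrite lt0n; apply/eqP => r0; apply: nw; exists 0 => j.
by have := ltn_ord j; rewrite [X in (_ < X)%N]r0.
Qed.

End Resolution.

Lemma in_ideal_variables (s : seq 'I_N) (p : S) :
  in_ideal [seq 'X_z | z <- s] p <-> mideal (meets [set z in s]) p.
Proof.
have -> : [seq 'X_z | z <- s] = [seq 'X_[g] | g <- [seq U_(z)%MM | z <- s]] :> seq S.
  by rewrite -map_comp.
rewrite in_ideal_monomials; suff eqM (m : 'X_{1..N}) :
    has (fun g => (g <= m)%MM) [seq U_(z)%MM | z <- s] = meets [set z in s] m.
  by rewrite (eq_mideal eqM).
apply/hasP/exists_inP => [[g /mapP[z zs ->] /mnm_lepP/(_ z)] | [z]].
  by rewrite mnm1E eqxx => mz; exists z; rewrite ?inE.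
rewrite inE => zs mz; exists U_(z)%MM; first exact: map_f.
by apply/mnm_lepP => j; rewrite mnm1E; case: eqP => [<-|].
Qed.

Lemma regular_variables (s : seq 'I_N) : uniq s ->
  regular_sequence [::] [seq 'X_z | z <- s] (k := k).
Proof.
move=> us; split.
  rewrite cat0s in_ideal_variables mideal_meetsE /kill comp_mpoly1.
  by rewrite oner_eq0.
move=> i; rewrite size_map => lti p; rewrite cat0s -map_take !in_ideal_variables.
case: s us lti => // z0 s us lti; rewrite (nth_map z0) // mulrC midealMX.
apply: mideal_sub => m /exists_inP[z zs]; rewrite mnmDE mnm1E => mz.
apply/exists_inP; exists z => //; move: mz.
rewrite (negPf (_ : _ != z)) ?addn0 //; apply: contraTneq zs => <-.
rewrite inE; move: us; rewrite -{1}(cat_take_drop i (z0 :: s)) (drop_nth z0) //.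
by rewrite cat_uniq /= negb_or => /and3P[_ /andP[]].
Qed.

End ProjectiveDimension.

(** * Connected closed graphs *)

Section ClosedGraphs.
Variables (n : nat) (e : rel 'I_n).
Hypotheses (symE : ssrbool.symmetric e) (closedE : closed_graph e).
Hypothesis connE : connected_graph e.
Implicit Types a b c d : 'I_n.

(** Edges oriented by the labelling. *)
Definition upward : rel 'I_n := [rel a b | e a b && (a < b)].

Lemma connect_last (T : finType) (r : rel T) (x y : T) : connect r x y ->
  x = y \/ exists2 z, connect r x z & r z y.
Proof.
case/connectP => p; elim/last_ind: p => [|p z _] /=; first by left.
rewrite rcons_path last_rcons => /andP[xp pz] ->; right.
by exists (last x p) => //; apply/connectP; exists p.
Qed.

Lemma connect_first (T : finType) (r : rel T) (x y : T) : connect r x y ->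
  x = y \/ exists2 z, r x z & connect r z y.
Proof.
case/connectP => [[|z p]] /=; first by left.
by case/andP=> xz zp ->; right; exists z => //; apply/connectP; exists p.
Qed.

Lemma connect_upward a b : e a b -> a < b -> connect upward a b.
Proof. by move=> ab ltab; apply/connect1/andP. Qed.

(** Two lower neighbours of [c] are adjacent or equal, so the summit [c] of
the walk from [a] to [b] can be cut off. *)
Lemma upward_comparable_up c a b : e a c -> a < c -> connect upward b c ->
  connect upward a b || connect upward b a.
Proof.
have [s] := ubnP c; elim: s c => // s IH c ltc ac ltac /connect_last[-> | [d bd]].
  by rewrite connect_upward.
case/andP=> dc ltdc; have [-> | nead] := eqVneq a d; first by rewrite bd orbT.
have ad : e a d.
  by apply: (closedE (i := c)); rewrite // 1?symE // ltac ltdc orbT.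
case: (ltngtP a d) => [ltad | ltda | /val_inj eqad]; last by rewrite eqad eqxx in nead.
  by apply: IH bd => //; apply: leq_trans ltdc _.
by rewrite (connect_trans bd) ?orbT // connect_upward // symE.
Qed.

(** As [upward_comparable_up], for a walk that first descends to [c]. *)
Lemma upward_comparable_down c a b : e a c -> c < a -> connect upward c b ->
  connect upward a b || connect upward b a.
Proof.
have [s] := ubnP (n - c); elim: s c => // s IH c ltc ac ltca /connect_first[<- | [d]].
  by rewrite orbC connect_upward // symE.
case/andP=> cd ltcd db; have [-> | nead] := eqVneq a d; first by rewrite db.
have ad : e a d.
  by apply: (closedE (i := c)); rewrite // 1?symE // ltca ltcd.
case: (ltngtP a d) => [ltad | ltda | /val_inj eqad]; last by rewrite eqad eqxx in nead.
  by rewrite (connect_trans _ db) // connect_upward.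
by apply: IH db => //; have := ltn_ord d; lia.
Qed.

(** Any walk can be straightened into a monotone one by removing its local
maxima and minima. *)
Lemma upward_comparable a b : connect upward a b || connect upward b a.
Proof.
case/connectP: (connE a b) => p; elim: p a => [|c p IH] a /=.
  by move=> _ ->; rewrite connect0.
case/andP=> ac cp ebl; case/orP: (IH c cp ebl) => [cb | bc].
  case: (ltngtP a c) => [ltac | ltca | /val_inj ->]; last by rewrite cb.
    by rewrite (connect_trans _ cb) // connect_upward.
  exact: upward_comparable_down cb.
case: (ltngtP a c) => [ltac | ltca | /val_inj ->]; last by rewrite bc orbT.
  exact: upward_comparable_up bc.
by rewrite orbC (connect_trans bc) // connect_upward // symE.
Qed.

Lemma upward_leq a b : connect upward a b -> a <= b.
Proof.
case/connectP=> p; elim: p a => [|c p IH] a /=; first by move=> _ ->.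
by case/andP=> /andP[_ ltac] cp ebl; apply: leq_trans (ltnW ltac) (IH c cp ebl).
Qed.

(** A monotone path between consecutive labels is a single edge. *)
Lemma closed_consecutive a b : b = a.+1 :> nat -> e a b.
Proof.
move=> eba; case/orP: (upward_comparable a b) => [|/upward_leq]; last by lia.
case/connect_first=> [eqab | [d /andP[ad ltad] /upward_leq ledb]].
  by move: eba; rewrite eqab; lia.
by rewrite (_ : b = d) //; apply: val_inj => /=; lia.
Qed.

Lemma closed_shrink_right a b c : e a b -> a < c -> c <= b -> e a c.
Proof.
move=> ab ltac; have [s] := ubnP (b - c); elim: s c ltac => // s IH c ltac les.
rewrite leq_eqVlt => /orP[/eqP/val_inj -> // | ltcb].
have ltc1 : c.+1 < n by apply: leq_ltn_trans (ltn_ord b).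
have ac1 : e a (Ordinal ltc1) by apply: IH => /=; lia.
have cc1 : e c (Ordinal ltc1) by apply: closed_consecutive.
apply: (closedE (i := Ordinal ltc1)); rewrite 1?symE //.
  by rewrite neq_ltn ltac.
by rewrite /= ltnS (ltnW ltac) ltnSn orbT.
Qed.

Lemma closed_shrink_left a c d : e a d -> a <= c -> c < d -> e c d.
Proof.
move=> ad; case: c; elim=> [|c IH] ltc /= leac ltcd.
  by rewrite (_ : Ordinal ltc = a) //; apply: val_inj; apply/eqP; rewrite /= eq_sym -leqn0.
move: leac; rewrite leq_eqVlt => /orP[/eqP eqa | ltac].
  by rewrite (_ : Ordinal ltc = a) //; apply: val_inj.
have cd := IH (ltnW ltc) ltac (ltnW ltcd).
have cc1 : e (Ordinal (ltnW ltc)) (Ordinal ltc) by apply: closed_consecutive.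
apply: (closedE (i := Ordinal (ltnW ltc))) => //.
  by rewrite neq_ltn /= ltcd.
by rewrite /= ltnSn (ltnW ltcd).
Qed.

Lemma closed_interval a b c d : e a b -> a <= c -> c < d -> d <= b -> e c d.
Proof.
move=> ab leac ltcd ledb.
have ltad : a < d by apply: leq_ltn_trans ltcd.
exact: closed_shrink_left (closed_shrink_right ab ltad ledb) leac ltcd.
Qed.

(** A walk from [a] to [b] that avoids the vertex [v] between them has to jump
over it, and the edge that does so contains the interval from [a] to [b]. *)
Lemma no_cut_point_skip a b (v : 'I_n) : v = a.+1 :> nat -> b = v.+1 :> nat ->
  ~ cut_point e v -> e a b.
Proof.
move=> eqv eqb nocut.
have : connect [rel x y | [&& e x y, x != v & y != v]] a b.
  apply/negPn/negP => nab; apply: nocut; exists a, b; split=> //.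
    by apply/eqP => av; move: eqv; rewrite av; lia.
  by apply/eqP => bv; move: eqb; rewrite bv; lia.
case/connectP=> p path_p eqbl.
suff [x [y [xy ltxv ltvy]]] : exists x y, [/\ e x y, x < v & v < y].
  by apply: closed_interval xy _ _ _; lia.
have ltav : a < v by lia.
have ltvb : v < b by lia.
elim: p a path_p eqbl ltav {eqv} => [|c p IH] a /=; first by move=> _ <-; lia.
case/andP=> /and3P[ac _ cv] cp eqbl ltav.
case: (ltngtP c v) => [ltcv | ltvc | /val_inj eqcv].
- exact: IH cp eqbl ltcv.
- by exists a, c.
- by rewrite eqcv eqxx in cv.
Qed.

End ClosedGraphs.

Section Staircase.
Variable m : nat.
Implicit Types (h : rel 'I_m) (i j a b : 'I_m).

Definition bipartite_graph h : rel ('I_m + 'I_m)%type :=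
  fun u v => match u, v with
             | inl i, inr j | inr j, inl i => h i j
             | _, _ => false
             end.

Record staircase h : Prop := Staircase {
  stair_leq : forall i j, h i j -> i <= j;
  stair_diag : forall i, h i i;
  stair_interval : forall a b i j, h a b -> a <= i -> i <= j -> j <= b -> h i j;
  stair_next : forall i j, j = i.+1 :> nat -> h i j
}.

Lemma card_ord_lt c : c <= m -> #|[set j : 'I_m | j < c]| = c.
Proof.
by move=> lecm; rewrite -sum1dep_card -(big_ord_widen m (fun=> 1)) // sum1_card card_ord.
Qed.

Definition full h : Prop := forall i j, i <= j -> h i j.

Lemma bipartite_sym h : ssrbool.symmetric (bipartite_graph h).
Proof. by case=> i [j|j]. Qed.

Lemma bipartite_irr h : irreflexive (bipartite_graph h).
Proof. by case. Qed.

Lemma initial_closed_graph_staircase (e : rel 'I_m.+1) :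
  simple_graph e -> closed_graph e -> connected_graph e ->
  (forall v, ~ cut_point e v) ->
  exists2 h, initial_closed_graph e = bipartite_graph h & staircase h.
Proof.
move=> [symE irrE] closedE connE nocut.
pose h i j := (widen_ord (leqnSn m) i < lift ord0 j)
  && e (widen_ord (leqnSn m) i) (lift ord0 j).
exists h => //; split.
- by move=> i j /andP[]; rewrite lift0.
- move=> i; rewrite /h lift0 /= ltnSn /=.
  by apply: closed_consecutive => //; rewrite lift0.
- move=> a b i j /andP[_ ab] leai leij lejb; rewrite /h lift0 ltnS leij /=.
  by apply: (closed_interval symE closedE connE ab); rewrite // !lift0.
- move=> i j eqj.
  have ltv : i.+1 < m.+1 by rewrite ltnS.
  rewrite /h lift0 /= eqj ltnW //=.
  by apply: (no_cut_point_skip symE closedE connE (v := Ordinal ltv)) => //; rewrite lift0 /= eqj.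
Qed.

Lemma mu_eq0 h : staircase h ->
  (forall i, mu (bipartite_graph h) i = 0) <-> full h.
Proof.
move=> stair.
have degE i : degree (bipartite_graph h) (inl i) = #|[set j | h i j]|.
  rewrite /degree -(card_imset _ (@inr_inj 'I_m 'I_m)).
  apply: eq_card => w; rewrite inE; case: w => [a | j].
    by apply/esym/negP => /imsetP[].
  by rewrite mem_imset ?inE //; apply: inr_inj.
have cardE i : #|[set j : 'I_m | i <= j]| = m - i.
  have := cardsC [set j : 'I_m | j < i]; rewrite card_ord card_ord_lt ?(ltnW (ltn_ord i)) //.
  have -> : ~: [set j : 'I_m | j < i] = [set j : 'I_m | i <= j].
    by apply/setP => j; rewrite !inE -leqNgt.
  lia.
have sub i : [set j | h i j] \subset [set j : 'I_m | i <= j].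
  by apply/subsetP => j; rewrite !inE; apply: stair_leq.
split=> [mu0 i j leij | fullh i].
  have := mu0 i; rewrite /mu degE subSS -cardE => /eqP; rewrite subn_eq0 => le.
  have /setP/(_ j) : [set j | h i j] = [set j : 'I_m | i <= j].
    by apply/eqP; rewrite eqEcard sub.
  by rewrite !inE leij.
rewrite /mu degE subSS -cardE; apply/eqP; rewrite subn_eq0.
by apply/subset_leq_card/subsetP => j; rewrite !inE; apply: fullh.
Qed.

End Staircase.

(** * Vertex covers of a staircase *)

Section StaircaseCovers.
Variable m : nat.
Implicit Types (h : rel 'I_m) (i j : 'I_m) (C D : {set 'I_m + 'I_m}).

Definition left_side : {set 'I_m + 'I_m} :=
  [set u | if u is inl _ then true else false].

Lemma left_side_cover h : vertex_cover (bipartite_graph h) left_side.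
Proof. by apply/vertex_coverP => [[i|i] [j|j]]; rewrite !inE. Qed.

Lemma left_side_irredundant h : staircase h -> irredundant (bipartite_graph h) left_side.
Proof.
move=> stair [i|i]; rewrite inE // => _.
by exists (inr i); rewrite ?inE //=; apply: stair_diag.
Qed.

Lemma card_left_side : #|left_side| = m.
Proof.
rewrite -[RHS]card_ord -cardsT -(card_imset _ (@inl_inj 'I_m 'I_m)).
apply: eq_card => u; rewrite inE; case: u => i; first by rewrite mem_imset ?inE //; apply: inl_inj.
by apply/esym/negP => /imsetP[].
Qed.

Definition strip (u : 'I_m + 'I_m) : 'I_m := match u with inl i | inr i => i end.

(** Each pair x_i, y_i is an edge, and meets the cover. *)
Lemma cover_strip h D : staircase h -> vertex_cover (bipartite_graph h) D ->
  strip @: D = [set: 'I_m].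
Proof.
move=> stair /vertex_coverP covD; apply/setP => i; rewrite inE.
case/orP: (covD (inl i) (inr i) (stair_diag stair i)) => iD; apply/imsetP;
  by [exists (inl i) | exists (inr i)].
Qed.

Lemma leq_card_cover h D : staircase h -> vertex_cover (bipartite_graph h) D ->
  m <= #|D|.
Proof.
move=> stair covD; rewrite -[X in X <= _]card_ord -cardsT -(cover_strip stair covD).
exact: leq_imset_card.
Qed.

Lemma full_card_cover h D : staircase h -> full h ->
  vertex_cover (bipartite_graph h) D -> irredundant (bipartite_graph h) D ->
  #|D| = m.
Proof.
move=> stair fullh covD irrD.
rewrite -[RHS]card_ord -cardsT -(cover_strip stair covD) card_in_imset //.
move/vertex_coverP: covD => covD.
have both i : inl i \in D -> inr i \in D -> False.
  move=> /irrD[[//|b] bD /= ib] /irrD[[a|//] aD /= ai].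
  have ab : h a b by apply: fullh; apply: leq_trans (stair_leq stair ai) (stair_leq stair ib).
  by have := covD (inl a) (inr b) ab; rewrite (negPf aD) (negPf bD).
by case=> i [j|j] iD jD /= eqij; rewrite eqij // in iD *; case: (both j).
Qed.

(** With i the last index such that x_i is not adjacent to the last y, the
cover consists of the x_a with a > i and of the neighbours of x_0, ..., x_i. It
contains y_0, ..., y_(i+1), hence at least m + 1 vertices. *)
Lemma not_full_cover h : staircase h -> ~ full h ->
  exists C, [/\ vertex_cover (bipartite_graph h) C,
    irredundant (bipartite_graph h) C & m < #|C|].
Proof.
case: m h => [|n] h stair nfull; first by case: nfull => [[]].
have ex : exists i : 'I_n.+1, ~~ h i ord_max.
  apply/existsP; apply: contra_notT nfull; rewrite negb_exists => /forallP H i j leij.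
  have /negPn imax := H i.
  exact: (stair_interval stair imax) (leqnn _) leij (leq_ord j).
have [i nhi maxi] : exists2 i : 'I_n.+1, ~~ h i ord_max &
    forall a : 'I_n.+1, i < a -> h a ord_max.
  have [i0 ni0] := ex; case: (@arg_maxnP _ i0 (fun i : 'I_n.+1 => ~~ h i ord_max)
    (fun i : 'I_n.+1 => i : nat) ni0).
  move=> i ni maxi; exists i => // a; rewrite ltnNge; apply: contraNT.
  exact: maxi.
have ltin : i < n.
  rewrite ltn_neqAle leq_ord andbT; apply: contraNneq nhi => eqi.
  by rewrite (_ : i = ord_max) ?(stair_diag stair) //; apply: val_inj.
pose C : {set 'I_n.+1 + 'I_n.+1} :=
  [set u : 'I_n.+1 + 'I_n.+1 | match u with inl a => i < a | inr b => (b < i) || h i b end].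
exists C; split.
- have key (a b : 'I_n.+1) : h a b -> (i < a) || ((b < i) || h i b).
    move=> ab; case: ltnP => //= leai; case: ltnP => //= leib.
    exact: (stair_interval stair ab).
  apply/vertex_coverP => [[a|a] [b|b]]; rewrite !inE //=; first exact: key.
  by rewrite orbC; apply: key.
- move=> [a|b]; rewrite inE => inC.
    exists (inr ord_max); last exact: maxi.
    by rewrite inE negb_or nhi -leqNgt /= ltnW.
  case/orP: inC => [ltbi | ib]; [exists (inl b) | exists (inl i)] => //; rewrite ?inE ?ltnn //.
    by rewrite -leqNgt ltnW.
  exact: stair_diag.
- have lti1 : i.+1 < n.+1 by [].
  (* One of x_a, y_a for each a, and y_(i+1), whose partner x_(i+1) is also
     in the cover. *)
  pose g (u : option 'I_n.+1) : 'I_n.+1 + 'I_n.+1 :=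
    if u is Some a then if i < a then inl a else inr a else inr (Ordinal lti1).
  have injg : injective g.
    move=> [a|] [b|] //=; first by case: (ltnP i a) (ltnP i b) => la [] lb // [->].
      by case: ltnP => // la [eqa]; move: la; rewrite eqa /= ltnn.
    by case: ltnP => // la [eqa]; move: la; rewrite -eqa /= ltnn.
  rewrite -[X in X <= _](_ : #|{: option 'I_n.+1}| = _); last by rewrite card_option card_ord.
  rewrite -cardsT -(card_imset _ injg); apply/subset_leq_card/subsetP.
  move=> _ /imsetP[[a|] _ ->] /=.
    case: (ltnP i a) => [lia | leai]; rewrite inE //.
    move: leai; rewrite leq_eqVlt => /orP[/eqP/val_inj->|->//].
    by rewrite stair_diag ?orbT.
  by rewrite inE (stair_next stair) ?orbT.
Qed.

End StaircaseCovers.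

(** * A quadratic syzygy from an induced matching *)

Section Regularity.
Local Open Scope ring_scope.
Variables (k : fieldType) (V : finType) (e : rel V).
Hypotheses (symE : ssrbool.symmetric e) (irrE : irreflexive e).
Notation N := #|V|.
Notation S := {mpoly k[N]}.
Notation I := (edge_ideal k e).
Implicit Types (p q : S).
Local Notation U v := (U_(enum_rank v)%MM : 'X_{1..N}).

(** Isolates the one pair of monomials that contributes to a coefficient of a
product. *)
Lemma mcoeffM_single p q (w f : 'X_{1..N}) :
  (forall m1 m2, (m1 + m2 = w + f)%MM -> p@_m1 != 0 -> q@_m2 != 0 -> m2 = f) ->
  (p * q)@_(w + f) = p@_w * q@_f.
Proof.
move=> H; have -> : p * q = (p * (q@_f)%:MP) * 'X_[f] + p * (q - q@_f *: 'X_[f]).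
  by rewrite -mul_mpolyC; ring.
rewrite mcoeffD addmC mcoeffMX mulrC mcoeffCM [_ * p@_w]mulrC.
rewrite [X in _ + X](_ : _ = 0) ?addr0 //; apply/eqP/negPn/negP => /mcoeffM_neq0.
case=> m1 [m2 [eqm pm1]]; rewrite mcoeffB mcoeff_scale mcoeffX.
have [<-|nef] := eqVneq f m2; first by rewrite mulr1 subrr eqxx.
rewrite mulr0 subr0 => qm2; move/eqP: nef; apply; apply/esym.
by apply: H pm1 qm2; rewrite -eqm addmC.
Qed.

Lemma edge_monomial_deg (m : 'X_{1..N}) : edge_monomial e m -> (1 < mdeg m)%N.
Proof.
case/edge_monomialP=> [u [v [uv mu mv]]].
rewrite mdegE (bigD1 (enum_rank u)) //= (bigD1 (enum_rank v)) /=.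
  by rewrite addnA; apply: leq_trans (leq_addr _ _); rewrite (leq_add mu mv).
by apply: contraTneq uv => /enum_rank_inj ->; rewrite irrE.
Qed.

(** Let f and g be the monomials of the two edges. Taking the coefficient of f
in the generators of the ideal gives an S-linear functional on the first free
module. On a generator of the second free module its value has no coefficient
at a monomial of degree at most 1 in the variables of g, for lack of edges
meeting both f and g. But on the Koszul syzygy of f and g its value has
coefficient 1 at g; so g itself occurs in the value on some generator, which
then has degree 4. *)
Theorem disjoint_edges_syzygy (a b c d : V) (F : graded_free_seq k N) :
  e a b -> e c d ->
  (forall u v, u \in [:: a; b] -> v \in [:: c; d] -> ~~ e u v) ->
  minimal_graded_free_resolution I F ->
  exists t : 'I_(gf_rank F 2), gf_deg t = 4%N.
Proof.
move=> ab cd gap resF.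
pose f : 'X_{1..N} := (U a + U b)%MM; pose g : 'X_{1..N} := (U c + U d)%MM.
have [v v1] := gf_aug_surj resF.
pose q := gf_d F 0 *m gf_aug F.
have qI l : mideal (edge_monomial e) (q l 0).
  apply/(in_edge_ideal irrE).
  have := (gf_exact0 resF (row l (gf_d F 0))).2.
  rewrite -row_mul mxE; apply.
  by exists (delta_mx 0 l); rewrite -rowE.
have qhom l : q l 0 \is (gf_deg l).-homog.
  rewrite mxE; apply: rpred_sum => j _.
  have [-> | nz] := eqVneq (gf_d F 0 l j) 0; first by rewrite mul0r rpred0.
  have [le dh] := gf_d_homog resF nz.
  by rewrite -(subnK le); apply: dhomogM => //; apply: gf_aug_homog resF _.
have d1q : gf_d F 1 *m q = 0.
  apply/row_matrixP => t; rewrite mulmxA row0 !row_mul.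
  suff -> : row t (gf_d F 1) *m gf_d F 0 = 0 by rewrite mul0mx.
  by apply/(gf_exact resF); exists (delta_mx 0 t); rewrite -rowE.
(* v lifts the unit of the quotient ring. *)
have v0 : ((v *m gf_aug F) 0 0)@_0 = 1.
  have /(in_edge_ideal irrE)/midealP/(_ 0%MM) := v1.
  rewrite mcoeffB mcoeff1 eqxx => H; apply/eqP; rewrite -subr_eq0.
  by apply/negPn/negP => /H/edge_monomial_deg; rewrite mdeg0.
have lift u w : e u w -> exists al, 'X_[U u + U w] *: v = al *m gf_d F 0.
  move=> uw; apply/(gf_exact0 resF); rewrite -scalemxAl mxE.
  apply/(idealMr (ideal_in_ideal _))/mem_in_ideal; rewrite mpolyXD.
  exact: mem_edge_ideal.
have [al alE] := lift a b ab; have [be beE] := lift c d cd.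
have [s sE] : exists s, 'X_[g] *: al - 'X_[f] *: be = s *m gf_d F 1.
  apply/(gf_exact resF); rewrite mulmxBl -!scalemxAl -alE -beE !scalerA.
  by rewrite [_ * 'X_[f]]mulrC subrr.
(* x *m cf is the value at x of the functional given by the coefficient of f. *)
pose cf : 'cV[S]_(gf_rank F 1) := \col_l ((q l 0)@_f)%:MP.
have cfE w n (x : 'M[S]_(n, _)) i : ((x *m cf) i 0)@_w = \sum_l (x i l)@_w * (q l 0)@_f.
  rewrite mxE mcoeff_sum; apply: eq_bigr => l _.
  by rewrite mxE mulrC mcoeffCM mulrC.
have ab0 : enum_rank a != enum_rank b.
  by apply: contraTneq ab => /enum_rank_inj ->; rewrite irrE.
have al1 : ((al *m cf) 0 0)@_0 = 1.
  have alq : (al *m q) 0 0 = (v *m gf_aug F) 0 0 * 'X_[f].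
    by rewrite mulmxA -alE -scalemxAl mxE mulrC.
  have := congr1 (mcoeff (f + 0)%MM) alq; rewrite mcoeffMX v0 addm0 cfE => <-.
  rewrite mxE mcoeff_sum; apply: eq_bigr => l _.
  rewrite -[f in RHS]add0m mcoeffM_single // => m1 m2; rewrite add0m => eqf _.
  move=> /(midealP _ _ (qI l))/edge_monomial_deg.
  have := congr1 mdeg eqf; rewrite !mdegD !mdeg1 => degf lt1.
  have /eqP : mdeg m1 = 0%N by lia.
  by rewrite mdeg_eq0 => /eqP m10; rewrite -eqf m10 add0m.
have vars z w : (w <= g)%MM -> (0 < w (enum_rank z))%N -> z \in [:: c; d].
  move=> /mnm_lepP/(_ (enum_rank z)) leg /leq_trans/(_ leg).
  rewrite mnmDE !mnm1E !inE !(inj_eq enum_rank_inj) ![_ == z]eq_sym.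
  by case: (z == c) (z == d) => [] [].
(* An edge dividing w f has both ends in f, because w divides g and has degree
   at most 1; so only the coefficient of f itself contributes at w f, the
   constant terms of the differential being zero by minimality. *)
have low t (w : 'X_{1..N}) : (w <= g)%MM -> (mdeg w <= 1)%N ->
    ((gf_d F 1 *m cf) t 0)@_w = 0.
  move=> leg degw; rewrite cfE.
  have := congr1 (fun M : 'cV[S]_(gf_rank F 2) => (M t 0)@_(w + f)) d1q.
  rewrite !mxE mcoeff0 mcoeff_sum => sum0; rewrite -[RHS]sum0.
  apply: eq_bigr => l _; rewrite mcoeffM_single // => m1 m2 eqm d1m1 qm2.
  have lef : (f <= m2)%MM.
    have := midealP _ _ (qI l) _ qm2.
    case/edge_monomialP=> [x [y [xy m2x m2y]]].
    have sup z : (0 < m2 (enum_rank z))%N ->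
        (z \in [:: a; b]) || (0 < w (enum_rank z))%N.
      move=> m2z; have := congr1 (fun M : 'X_{1..N} => M (enum_rank z)) eqm.
      rewrite !mnmDE !mnm1E !inE !(inj_eq enum_rank_inj) ![_ == z]eq_sym.
      by case: (z == a) (z == b) => [] []; lia.
    have nexy : x != y by apply: contraTneq xy => ->; rewrite irrE.
    case/orP: (sup x m2x) (sup y m2y) => [xab | wx]; case/orP => [yab | wy].
    - have [eqx eqy] : [/\ (x == a) || (x == b) & (y == a) || (y == b)].
        by move: xab yab; rewrite !inE.
      have [m2a m2b] : (0 < m2 (enum_rank a))%N /\ (0 < m2 (enum_rank b))%N.
        case/orP: eqx eqy nexy => /eqP ? /orP[] /eqP ?; subst x y => //;
          by rewrite eqxx.
      by rewrite lem_pair // m2a.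
    - by have := gap x y xab (vars _ _ leg wy); rewrite xy.
    - by have := gap y x yab (vars _ _ leg wx); rewrite symE xy.
    - have := degw; rewrite mdegE (bigD1 (enum_rank x)) //= (bigD1 (enum_rank y)) /=.
        rewrite addnA => /(leq_trans (leq_addr _ _)).
        by rewrite leqNgt (leq_add wx wy).
      by rewrite (inj_eq enum_rank_inj) eq_sym.
  have eqm2 := submK lef; apply/eqP; apply: contraTT d1m1 => nem2.
  suff -> : m1 = 0%MM by rewrite (gf_minimal resF) eqxx.
  apply/eqP; rewrite -mdeg_eq0.
  have degm2 : mdeg (m2 - f)%MM != 0%N.
    by rewrite mdeg_eq0; apply: contra nem2 => /eqP e0; rewrite -eqm2 e0 add0m.
  have := congr1 mdeg eqm; have := congr1 mdeg eqm2; rewrite !mdegD.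
  lia.
have sLa : (('X_[g] *: al - 'X_[f] *: be) *m cf) 0 0 = (s *m (gf_d F 1 *m cf)) 0 0.
  by rewrite sE mulmxA.
have nfg : ~~ (f <= g)%MM.
  apply/negP => lefg; have acd : a \in [:: c; d].
    by apply: (vars a f lefg); rewrite mnmDE mnm1E eqxx.
  by apply: (negP (gap b a _ acd)); rewrite 1?symE // !inE eqxx orbT.
have linE (x y : 'M[S]_1) p p' : (p *: x - p' *: y) 0 0 = x 0 0 * p - y 0 0 * p'.
  by rewrite !mxE; ring.
have := congr1 (mcoeff (g + 0)%MM) sLa.
rewrite mulmxBl -!scalemxAl linE mcoeffB mcoeffMX al1 addm0.
have -> : ((be *m cf) 0 0 * 'X_[f])@_g = 0.
  apply/eqP/negPn/negP => /mcoeffM_neq0[m1 [m2 [eqg _]]].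
  rewrite mcoeffX; have [eqf _|] := eqVneq f m2; last by rewrite eqxx.
  by move/negP: nfg; apply; rewrite eqg -eqf lem_addl.
rewrite subr0 mxE mcoeff_sum => sum1.
have exnz (J : finType) (G : J -> k) : \sum_t G t != 0 -> exists t, G t != 0.
  move=> nz; apply/existsP; apply: contraNT nz; rewrite negb_exists => /forallP G0.
  by rewrite big1 // => t _; apply/eqP; move: (G0 t); rewrite negbK.
have [|t /mcoeffM_neq0[m1 [m2 [eqg _ La2]]]] :=
    exnz _ (fun t => (s 0 t * (gf_d F 1 *m cf) t 0)@_g).
  by rewrite -sum1 oner_eq0.
have leg : (m2 <= g)%MM by rewrite eqg lem_addl.
have degm2 : (1 < mdeg m2)%N by rewrite ltnNge; apply: contra La2 => /(low t _ leg)->.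
have {m1 eqg leg degm2} eqm2 : m2 = g.
  have := congr1 mdeg eqg; rewrite !mdegD !mdeg1 => degg.
  have /eqP : mdeg m1 = 0%N by lia.
  by rewrite mdeg_eq0 => /eqP m10; rewrite eqg m10 add0m.
move: La2; rewrite eqm2 cfE => /exnz[l]; rewrite mulf_eq0 negb_or => /andP[dg qf].
have degf : mdeg f = 2%N by rewrite mdegD !mdeg1.
have degg : mdeg g = 2%N by rewrite mdegD !mdeg1.
have degl : gf_deg l = 2%N.
  have := dhomog_mf (qhom l); move/(_ f); rewrite mcoeff_msupp qf => /(_ isT) <-.
  exact: degf.
have dnz : gf_d F 1 t l != 0 by apply: contraNneq dg => ->; rewrite mcoeff0.
have [le dh] := gf_d_homog resF dnz.
exists t; have := dhomog_mf dh; move/(_ g); rewrite mcoeff_msupp dg => /(_ isT).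
by move/(etrans (esym degg)); move: le; rewrite degl; lia.
Qed.

End Regularity.

(** * A regular sequence for a full staircase *)

Section RegularSequence.
Local Open Scope ring_scope.
Variables (k : fieldType) (m : nat) (h : rel 'I_m).
Hypotheses (stair : staircase h) (fullh : full h).
Notation V := ('I_m + 'I_m)%type.
Notation N := #|{: V}|.
Notation S := {mpoly k[N]}.
Notation I := (edge_ideal k (bipartite_graph h)).
Implicit Types (p q : S) (a b : 'I_m) (i : nat).

Local Notation xv a := (enum_rank (inl a : V)).
Local Notation yv a := (enum_rank (inr a : V)).

Definition diff_var a : S := 'X_(xv a) - 'X_(yv a).
Definition diff_vars : seq S := [seq diff_var a | a <- enum 'I_m].

(** Identifies y_b with x_b for b < i. *)
Definition glue i (v : V) : V :=
  if v is inr b then if (b < i)%N then inl b else v else v.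

Definition glue_poly i p : S :=
  p \mPo [tuple 'X_(enum_rank (glue i (enum_val z))) | z < N].

Lemma glue_polyX i v : glue_poly i 'X_(enum_rank v) = 'X_(enum_rank (glue i v)).
Proof. by rewrite /glue_poly comp_mpolyXU -tnth_nth tnth_mktuple enum_rankK. Qed.

(** The monomials of the image of the edge ideal under the identification of
y_b with x_b for b < i, a monomial ideal again. *)
Definition glued_monomial i (mo : 'X_{1..N}) : bool :=
  [exists a : 'I_m, exists b : 'I_m,
    (a <= b)%N && (U_(xv a) + U_(enum_rank (glue i (inr b))) <= mo)%MM].

Lemma glued_monomialP i (mo : 'X_{1..N}) :
  reflect (exists a b : 'I_m, (a <= b)%N /\
      (U_(xv a) + U_(enum_rank (glue i (inr b))) <= mo)%MM)
    (glued_monomial i mo).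
Proof.
apply: (iffP existsP) => [[a /existsP[b /andP H]] | [a [b H]]]; exists a.
  by exists b.
by apply/existsP; exists b; apply/andP.
Qed.

Lemma upclosed_glued i : upclosed (glued_monomial i).
Proof.
move=> mo mo' /glued_monomialP[a [b [leab le]]]; apply/glued_monomialP.
by exists a, b; split=> //; apply: lepm_trans le (lem_addr _ _).
Qed.

Lemma mem_take_diff_vars i g :
  reflect (exists2 a : 'I_m, (a < i)%N & g = diff_var a) (g \in take i diff_vars).
Proof.
have memE a : (a \in take i (enum 'I_m)) = (a < i)%N.
  rewrite -(mem_map val_inj) map_take val_enum_ord take_iota mem_iota /=.
  by rewrite add0n leq_min ltn_ord andbT.
rewrite -map_take; apply: (iffP mapP) => [[a + ->] | [a lta ->]].
  by rewrite memE; exists a.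
by exists a; rewrite ?memE.
Qed.

Lemma bipartite_edgeP (u v : V) : bipartite_graph h u v ->
  exists a b : 'I_m, (a <= b)%N /\ ((u, v) = (inl a, inr b) \/ (u, v) = (inr b, inl a)).
Proof.
case: u v => [a|b] [a'|b'] //= hab; [exists a, b' | exists a', b];
  by split; [apply: (stair_leq stair) | auto].
Qed.

(** The quotient by the first i differences is the quotient by a monomial
ideal of the ring in which y_a is replaced by x_a for a < i. For the implication
from right to left, a polynomial is congruent to its image modulo these
differences. *)
Lemma in_ideal_glue i p :
  in_ideal (I ++ take i diff_vars) p <-> mideal (glued_monomial i) (glue_poly i p).
Proof.
set J := I ++ _; have idJ := ideal_in_ideal J.
have idK := ideal_mideal k (@upclosed_glued i).
split.
  apply: (@in_ideal_min _ _ (fun p => mideal (glued_monomial i) (glue_poly i p))).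
    split=> [|a x y x0 y0]; first by rewrite /glue_poly comp_mpoly0; exact: (ideal0 idK).
    by rewrite /glue_poly rmorphD rmorphM; apply: idK.2.
  move=> g; rewrite mem_cat => /orP[/edge_ideal_gens[u [v [uv ->]]] | ].
    rewrite /glue_poly rmorphM /= -!/(glue_poly _ _) !glue_polyX -mpolyXD midealX.
    have [a [b [leab [[-> ->]|[-> ->]]]]] := bipartite_edgeP uv; apply/glued_monomialP;
      by exists a, b; split; rewrite // 1?addmC /= lepm_refl.
  case/mem_take_diff_vars=> a lta ->.
  rewrite /glue_poly rmorphB /= -!/(glue_poly _ _) !glue_polyX /= lta subrr.
  exact: (ideal0 idK).
have JM x y : in_ideal J (x - glue_poly i x) -> in_ideal J (y - glue_poly i y) ->
    in_ideal J (x * y - glue_poly i (x * y)).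
  move=> Jx Jy; rewrite /glue_poly rmorphM /= -!/(glue_poly _ _).
  have -> : x * y - glue_poly i x * glue_poly i y
      = y * (x - glue_poly i x) + glue_poly i x * (y - glue_poly i y) by ring.
  by apply: idJ.2 => //; apply: (idealMl idJ).
have JX v : in_ideal J ('X_(enum_rank v) - glue_poly i 'X_(enum_rank v)).
  rewrite glue_polyX; case: v => [a|b] /=; first by rewrite subrr; exact: (ideal0 idJ).
  case: ltnP => ltb; last by rewrite subrr; exact: (ideal0 idJ).
  rewrite -opprB; apply: (idealN idJ); apply: mem_in_ideal; rewrite mem_cat.
  by apply/orP; right; apply/mem_take_diff_vars; exists b.
have J1 : in_ideal J (1 - glue_poly i 1).
  by rewrite /glue_poly comp_mpoly1 subrr; exact: (ideal0 idJ).
have Jmod q : in_ideal J (q - glue_poly i q).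
  rewrite [q]mpolyE; elim/big_ind: _ => [|x y Jx Jy|mo _].
  - by rewrite /glue_poly comp_mpoly0 subrr; exact: (ideal0 idJ).
  - by rewrite /glue_poly comp_mpolyD opprD addrACA; apply: (idealD idJ).
  rewrite /glue_poly comp_mpolyZ -scalerBr -mul_mpolyC; apply: (idealMl idJ).
  rewrite -/(glue_poly _ _) mpolyXE_id; elim/big_ind: _ => // z _.
  elim: (mo z) => [|n IHn] //; rewrite exprS; apply: JM => //.
  by rewrite -(enum_valK z).
move=> Kp; rewrite -(subrK (glue_poly i p) p); apply: (idealD idJ) => //.
apply: (mideal_ideal idJ _ Kp) => mo /glued_monomialP[a [b [leab le]]].
rewrite -(submK le) mpolyXD; apply: (idealMl idJ).
rewrite mpolyXD; have Jab : in_ideal J ('X_(xv a) * 'X_(yv b)).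
  apply: mem_in_ideal; rewrite mem_cat mem_edge_ideal //.
  exact: fullh.
have := idealB idJ Jab (JM _ _ (JX (inl a)) (JX (inr b))).
by rewrite opprB addrC subrK /glue_poly rmorphM /= -!/(glue_poly _ _) !glue_polyX.
Qed.

(** If a monomial [mo] of [q] is not in the ideal, then neither x_a nor y_a can
carry it there: x_a mo in the ideal requires some y_b with b >= a in [mo], and
y_a mo requires some x_a' with a' <= a, and x_a' y_b is an edge. As x_a y_a is
an edge as well, x_a mo or y_a mo then survives in the product. *)
Lemma glued_cancel a (q : S) :
  mideal (glued_monomial a) (diff_var a * q) -> mideal (glued_monomial a) q.
Proof.
move/midealP=> Kq; apply/midealP => mo qmo; have [//|nM] := boolP (glued_monomial a mo).
have nexy : xv a != yv a by apply/negP => /eqP/enum_rank_inj.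
have edge (mo' : 'X_{1..N}) :
    (0 < mo' (xv a))%N -> (0 < mo' (yv a))%N -> glued_monomial a mo'.
  move=> mx my; apply/glued_monomialP; exists a, a; split=> //=; rewrite ltnn.
  by rewrite lem_pair // mx.
(* A monomial x mo outside the ideal must cancel in (x - y) q against y mo' for
   some mo' in q; then y divides mo, and x y is an edge. *)
have shift (x y : 'I_N) : x != y ->
    (forall mo', (('X_x - 'X_y) * q)@_mo' != 0 -> glued_monomial a mo') ->
    (forall mo' : 'X_{1..N}, (0 < mo' x)%N -> (0 < mo' y)%N -> glued_monomial a mo') ->
    glued_monomial a (mo + U_(x))%MM.
  move=> nxy K xyM; have [//|nMx] := boolP (glued_monomial a (mo + U_(x))%MM).
  have /eqP : (('X_x - 'X_y) * q)@_(mo + U_(x)) == 0.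
    by apply: contraNT nMx; apply: K.
  rewrite mulrBl mcoeffB mulrC addmC mcoeffMX => /eqP; rewrite subr_eq0 => /eqP eqq.
  move: qmo; rewrite eqq => /mcoeffM_neq0[m1 [m2 [eqm]]].
  rewrite mcoeffX; have [eqU _ _|] := eqVneq U_(y)%MM m1; last by rewrite eqxx.
  case/negP: nMx; rewrite addmC; apply: xyM.
    by rewrite mnmDE mnm1E eqxx.
  by rewrite eqm mnmDE -eqU mnm1E eqxx.
have avoid (u v w : 'I_N) : u != w -> v != w ->
    (U_(u) + U_(v) <= mo + U_(w))%MM -> (U_(u) + U_(v) <= mo)%MM.
  move=> uw vw /mnm_lepP le; apply/mnm_lepP => z; have := le z.
  rewrite !mnmDE !mnm1E; have [<-|_] := eqVneq w z; last by rewrite addn0.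
  by rewrite (negPf uw) (negPf vw).
have /glued_monomialP[a1 [b1 [le1 div1]]] := shift _ _ nexy Kq edge.
have /glued_monomialP[a2 [b2 [le2 div2]]] : glued_monomial a (mo + U_(yv a))%MM.
  apply: (shift (yv a) (xv a)); first by rewrite eq_sym.
    move=> mo'; rewrite -opprB mulNr mcoeffN oppr_eq0; apply: Kq.
  by move=> mo' my mx; apply: edge.
(* The edge dividing x_a mo does not divide mo, so it contains x_a. *)
have eqa1 : a1 = a.
  apply/eqP; apply: contraNT nM => nea; apply/glued_monomialP; exists a1, b1; split=> //.
  apply: avoid div1; rewrite (inj_eq enum_rank_inj) //=.
  by case: ltnP => // ltb; apply: contraTneq ltb => -[->]; rewrite ltnn.
have eqb2 : b2 = a.
  apply/eqP; apply: contraNT nM => neb; apply/glued_monomialP; exists a2, b2; split=> //.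
  by apply: avoid div2; rewrite (inj_eq enum_rank_inj) //=; case: ltnP.
rewrite eqa1 in le1 div1; rewrite eqb2 in le2 div2.
case/negP: nM; apply/glued_monomialP; exists a2, b1; split; first exact: leq_trans le1.
move/mnm_lepP/(_ (yv b1)): div1; move/mnm_lepP/(_ (xv a2)): div2.
have nlt : (b1 < a)%N = false by rewrite ltnNge le1.
rewrite /= nlt ltnn !mnmDE !mnm1E !eqxx !(inj_eq enum_rank_inj) /=.
rewrite !addn0 !add0n => mox moy.
by rewrite lem_pair ?(inj_eq enum_rank_inj) // mox.
Qed.

Theorem full_regular_sequence :
  [/\ homog_pos_degree diff_vars, regular_sequence I diff_vars & size diff_vars = m].
Proof.
have sz : size diff_vars = m by rewrite size_map size_enum_ord.
split=> //.
  move=> _ /mapP[a _ ->]; exists 1%N => //; apply: rpredB; rewrite dhomogX;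
  by apply/eqP; exact: mdeg1.
split.
  rewrite -[diff_vars]take_size in_ideal_glue /glue_poly comp_mpoly1.
  rewrite -mpolyX0 midealX => /glued_monomialP[a [b [_ /mnm_lepP/(_ (xv a))]]].
  by rewrite mnmDE mnm1E eqxx mnm0E.
rewrite sz => i lti p; pose a := Ordinal lti.
have -> : diff_vars`_i = diff_var a.
  by rewrite (nth_map a) ?size_enum_ord //; congr diff_var; apply: val_inj; rewrite /= nth_enum_ord.
rewrite !in_ideal_glue /glue_poly rmorphM rmorphB /= -!/(glue_poly _ _).
by rewrite !glue_polyX /= ltnn; apply: (@glued_cancel a).
Qed.

End RegularSequence.

(** * Linear resolutions by mapping cones *)

Lemma dependent_choice (T : nat -> Type) (P : forall i, T i -> Prop)
    (R : forall i, T i -> T i.+1 -> Prop) (x0 : T 0) :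
  P 0 x0 -> (forall i x, P i x -> exists y, P i.+1 y /\ R i x y) ->
  exists f : forall i, T i,
    f 0 = x0 /\ forall i, P i (f i) /\ R i (f i) (f i.+1).
Proof.
move=> Px0 next.
pose step i (x : {x : T i | P i x}) :=
  constructive_indefinite_description _ (next i _ (proj2_sig x)).
pose g := fix g i : {x : T i | P i x} :=
  if i is j.+1 then
    exist _ (proj1_sig (step j (g j))) (proj1 (proj2_sig (step j (g j))))
  else exist _ x0 Px0.
exists (fun i => proj1_sig (g i)); split=> // i; split; first exact: proj2_sig.
exact: proj2 (proj2_sig (step i (g i))).
Qed.

Section LinearResolutions.
Local Open Scope ring_scope.
Variables (k : fieldType) (N : nat).
Notation S := {mpoly k[N]}.
Implicit Types (M : pred 'X_{1..N}) (r : nat -> nat) (c i : nat).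

(** The ranks of the whole complex, whose module in degree 0 is S itself;
[r i] is the rank in degree i + 1. *)
Definition aug_rank r i : nat := if i is j.+1 then r j else 1.

Definition step_degree c i : nat := if i is 0%N then c else 1.

(** A free resolution of S modulo the monomial ideal of [M], generated in
degree [c], in which all later differentials have linear entries. *)
Record linear_resolution c M r (d : forall i, 'M[S]_(r i, aug_rank r i)) : Prop :=
  LinearResolution {
    lin_homog : forall i a b, d i a b \is (step_degree c i).-homog;
    lin_image : forall v : 'rV[S]_1, mideal M (v 0 0) <-> exists w, v = w *m d 0%N;
    lin_exact : forall i (v : 'rV[S]_(r i)),
      v *m d i = 0 <-> exists w, v = w *m d i.+1
  }.

Lemma lin_comp c M r d : @linear_resolution c M r d ->
  forall i n (A : 'M_(n, _)), A *m d i.+1 *m d i = 0.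
Proof.
move=> res i n A; apply/row_matrixP => a; rewrite row0 !row_mul.
by apply/(lin_exact res); exists (row a A).
Qed.

Lemma lift_rows n p q (D : 'M[S]_(n, q)) (B : 'M[S]_(p, q)) :
  (forall a, exists w, row a D = w *m B) -> exists A, A *m B = D.
Proof.
move=> /(fin_all_exists (U := fun=> 'rV[S]_p))[w wB].
exists (\matrix_a w a); apply/row_matrixP => a.
by rewrite row_mul rowK -wB.
Qed.

(** A factorization can be replaced by its homogeneous part. *)
Lemma homogeneous_lift e e' n p q (D : 'M[S]_(n, q)) (B : 'M[S]_(p, q)) A :
  (forall a b, B a b \is e.-homog) -> (forall a b, D a b \is (e' + e).-homog) ->
  A *m B = D ->
  exists A' : 'M[S]_(n, p), (forall a b, A' a b \is e'.-homog) /\ A' *m B = D.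
Proof.
move=> Be De AB; exists (map_mx (pihomog mdeg e') A); split.
  by move=> a b; rewrite mxE; apply: pihomogP.
apply/matrixP => a b; rewrite -[RHS](pihomog_dE (De a b)) -AB !mxE raddf_sum.
apply: eq_bigr => j _; rewrite mxE /= (pihomogMr _ _ (Be j b)).
by rewrite leq_addl addnK.
Qed.

Section MappingCone.
Variables (c : nat) (M : pred 'X_{1..N}) (g : 'X_{1..N}).
Variables (rF rK : nat -> nat).
Variable dF : forall i, 'M[S]_(rF i, aug_rank rF i).
Variable dK : forall i, 'M[S]_(rK i, aug_rank rK i).
Hypothesis resF : linear_resolution c M dF.
Hypothesis resK : linear_resolution 1 (fun m => M (m + g)%MM) dK.
Hypotheses (degg : mdeg g = c) (upM : upclosed M).

Lemma homK i a b : dK i a b \is 1.-homog.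
Proof. by have := lin_homog resK a b; rewrite (_ : step_degree 1 i = 1%N) //; case: (i). Qed.

(** Multiplication by [g] maps S / (M : g) to S / M; this is its lift to the
resolutions. *)
Lemma colon_chain_map :
  exists phi : forall i, 'M[S]_(aug_rank rK i, aug_rank rF i),
    [/\ phi 0%N = ('X_[g])%:M,
      forall i a b, phi i a b \is (step_degree c i).-homog &
      forall i, phi i.+1 *m dF i = dK i *m phi i].
Proof.
pose P i (A : 'M[S]_(aug_rank rK i, aug_rank rF i)) :=
  (forall a b, A a b \is (step_degree c i).-homog)
  /\ exists B : 'M[S]_(rK i, rF i), B *m dF i = dK i *m A.
pose R i (A : 'M[S]_(aug_rank rK i, aug_rank rF i))
         (B : 'M[S]_(aug_rank rK i.+1, aug_rank rF i.+1)) :=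
  B *m dF i = dK i *m A.
have [||f [f0 fPR]] := @dependent_choice _ P R ('X_[g])%:M.
- split=> [a b | ].
    by rewrite !ord1 mxE eqxx mulr1n dhomogX; apply/eqP.
  apply: lift_rows => a; apply/(lin_image resF).
  rewrite row_mul mul_mx_scalar mxE mulrC midealMX.
  by apply/(lin_image resK); exists (delta_mx 0 a); rewrite -rowE.
- move=> i A [homA [B0 B0A]].
  have homD a b : (dK i *m A) a b \is (1 + step_degree c i).-homog.
    rewrite mxE; apply: rpred_sum => j _; apply: dhomogM => //.
    exact: homK.
  have [B [homB BA]] := homogeneous_lift (lin_homog resF (i := i)) homD B0A.
  exists B; split=> //; split=> //.
  apply: lift_rows => a; apply/(lin_exact resF).
  rewrite row_mul -mulmxA BA mulmxA; rewrite -row_mul.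
  have -> : dK i.+1 *m dK i = 0.
    by have := lin_comp resK (i := i) 1%:M; rewrite mul1mx.
  by rewrite row0 mul0mx.
exists f; split=> // [i|i]; last exact: (fPR i).2.
exact: (fPR i).1.1.
Qed.

Definition cone_rank i : nat := (rF i + aug_rank rK i)%N.

(** In degree i + 1 the cone is the sum of the module of [dF] in degree i + 1
and of the module of [dK] in degree i. *)
Definition cone_diff (phi : forall i, 'M[S]_(aug_rank rK i, aug_rank rF i)) i :
    'M[S]_(cone_rank i, aug_rank cone_rank i) :=
  match i with
  | 0%N => col_mx (dF 0%N) (phi 0%N)
  | j.+1 => block_mx (dF j.+1) 0 (phi j.+1) (- dK j)
  end.

Lemma mideal_add_monomial (p : S) :
  mideal (fun m => M m || (g <= m)%MM) p <->
  exists q, mideal M (p - q * 'X_[g]).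
Proof.
have idM := ideal_mideal k upM; split=> [|[q Mq]].
  apply: (@mideal_ideal _ _ _ (fun p => exists q, mideal M (p - q * 'X_[g]))).
    split=> [|a x y [q xq] [q' yq']].
      by exists 0; rewrite mul0r subr0; exact: (ideal0 idM).
    exists (a * q + q').
    have -> : a * x + y - (a * q + q') * 'X_[g]
      = a * (x - q * 'X_[g]) + (y - q' * 'X_[g]) by ring.
    exact: idM.2.
  move=> m /orP[Mm | lem]; first by exists 0; rewrite mul0r subr0 midealX.
  exists 'X_[m - g]; rewrite -mpolyXD submK // subrr; exact: (ideal0 idM).
have upM' : upclosed (fun m => M m || (g <= m)%MM).
  move=> m m' /orP[/upM-> // | le].
  by rewrite (lepm_trans le) ?orbT // lem_addr.
have idM' := ideal_mideal k upM'.
rewrite -(subrK (q * 'X_[g]) p); apply: (idealD idM').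
  by apply: mideal_sub Mq => m ->.
by apply: (idealMl idM'); rewrite midealX lepm_refl orbT.
Qed.

(** From 0 -> S / (M : g) -> S / M -> S / (M + g) -> 0. The cone stays linear
since [g] has the degree of the other generators and the colon ideal is
generated by variables. *)
Theorem mapping_cone : exists d : forall i, 'M[S]_(cone_rank i, aug_rank cone_rank i),
  linear_resolution c (fun m => M m || (g <= m)%MM) d.
Proof.
have [phi [phi0 homphi phid]] := colon_chain_map.
have mulX (u : 'rV[S]_1) : u *m ('X_[g])%:M = u 0 0 *: ('X_[g])%:M.
  by apply/rowP => j; rewrite !ord1 mul_mx_scalar !mxE eqxx mulr1n mulrC.
(* The cycles of the cone: the condition on v2 alone comes from exactness of dK,
   in degree 0 from the definition of the colon ideal. *)
have zeroE i (v1 : 'rV_(rF i)) (v2 : 'rV_(aug_rank rK i)) :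
    row_mx v1 v2 *m cone_diff phi i = 0 <->
    v1 *m dF i + v2 *m phi i = 0 /\ (exists u, v2 = u *m dK i).
  case: i v1 v2 => [|i] v1 v2 /=.
    rewrite mul_row_col; split=> [v0 | []//]; split=> //.
    apply/(lin_image resK); rewrite -midealMX.
    have -> : v2 0 0 * 'X_[g] = (v2 *m phi 0%N) 0 0.
      by rewrite phi0 mulX !mxE eqxx mulr1n.
    apply/(lin_image resF); exists (- v1).
    by rewrite mulNmx; apply/eqP; rewrite -addr_eq0 addrC v0.
  rewrite mul_row_block mulmx0 add0r mulmxN -[0 in X in X <-> _]row_mx0.
  split=> [/eq_row_mx[-> /eqP] | [-> /(lin_exact resK) ->]]; last by rewrite oppr0.
  by rewrite oppr_eq0 => /eqP/(lin_exact resK).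
exists (cone_diff phi); split.
- case=> [|i] a b /=.
    rewrite mxE; case: split => j; first exact: (lin_homog resF).
    exact: homphi.
  rewrite mxE; case: split => j; rewrite mxE; case: split => l.
  + exact: (lin_homog resF (i := i.+1)).
  + by rewrite mxE rpred0.
  + exact: (homphi i.+1).
  + by rewrite mxE rpredN; apply: homK.
- move=> v; rewrite mideal_add_monomial /= phi0.
  split=> [[q Mq] | [w ->]].
    have /(lin_image resF)[w wE] : mideal M ((v - q *: ('X_[g])%:M : 'rV[S]_1) 0 0).
      by rewrite !mxE eqxx mulr1n.
    exists (row_mx w q%:M); rewrite mul_row_col -wE mulX mxE eqxx mulr1n.
    by rewrite subrK.
  exists (rsubmx w 0 0); rewrite -[w]hsubmxK mul_row_col row_mxKr mulX.
  have /(lin_image resF) : exists w', lsubmx w *m dF 0%N = w' *m dF 0%N by exists (lsubmx w).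
  rewrite [X in mideal M (X - _)]mxE [X in mideal M (_ + X - _)]mxE.
  by rewrite [(_%:M) 0 0]mxE eqxx mulr1n addrK.
- move=> i v; rewrite -[v]hsubmxK.
  set v1 := lsubmx v; set v2 := rsubmx v.
  have splitE n1 n2 (a1 b1 : 'rV[S]_n1) (a2 b2 : 'rV[S]_n2) :
      row_mx a1 a2 = row_mx b1 b2 <-> a1 = b1 /\ a2 = b2.
    by split=> [/eq_row_mx | [-> ->]].
  have nextE (w : 'rV[S]_(cone_rank i.+1)) : row_mx v1 v2 = w *m cone_diff phi i.+1
     <-> v1 = lsubmx w *m dF i.+1 + rsubmx w *m phi i.+1 /\ v2 = - (rsubmx w *m dK i).
    rewrite -{1}[w]hsubmxK /= mul_row_block mulmx0 add0r mulmxN.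
    exact: splitE.
  rewrite zeroE; split=> [[v0 [u v2E]] | [w /nextE[-> ->]]].
    have /(lin_exact resF)[w wE] : (v1 + u *m phi i.+1) *m dF i = 0.
      by rewrite mulmxDl -mulmxA phid mulmxA -v2E.
    exists (row_mx w (- u)); apply/nextE; rewrite row_mxKl row_mxKr -wE v2E.
    by rewrite !mulNmx opprK addrK; split.
  split; last by exists (- rsubmx w); rewrite mulNmx.
  by rewrite mulmxDl (lin_comp resF) add0r mulNmx -!mulmxA phid subrr.
Qed.

End MappingCone.
(** [s] bounds the projective dimension. *)
Definition linearly_resolved c M (s : nat) : Prop :=
  exists r (d : forall i, 'M[S]_(r i, aug_rank r i)),
    linear_resolution c M d /\ forall i, (s < i)%N -> aug_rank r i = 0%N.

Lemma eq_linearly_resolved c M M' s : M =1 M' ->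
  linearly_resolved c M s -> linearly_resolved c M' s.
Proof.
move=> eqM [r [d [[dhom dimage dexact] dlen]]]; exists r, d; split=> //.
by split=> // v; rewrite -(eq_mideal eqM).
Qed.

Lemma linearly_resolvedW c M s s' : (s <= s')%N ->
  linearly_resolved c M s -> linearly_resolved c M s'.
Proof.
move=> le [r [d [res len]]]; exists r, d; split=> // i lti.
by apply: len; apply: leq_ltn_trans lti.
Qed.

Lemma linearly_resolved0 c : linearly_resolved c pred0 0.
Proof.
exists (fun=> 0%N), (fun i => 0); split; last by case.
split=> [i [] // | v | i v].
  split=> [/midealP v0 | [w ->]]; last first.
    by rewrite mulmx0 mxE /mideal msupp0.
  exists 0; rewrite mul0mx; apply/rowP => j; rewrite !ord1 mxE.
  by apply/mpolyP => mo; rewrite mcoeff0; apply/eqP/negPn/negP => /v0.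
split=> [_ | _]; first by exists 0; rewrite [v]thinmx0 mul0mx.
by rewrite mulmx0.
Qed.

Lemma linearly_resolved_cone c M g s t : upclosed M -> mdeg g = c ->
  linearly_resolved c M s ->
  linearly_resolved 1 (fun m => M (m + g)%MM) t ->
  linearly_resolved c (fun m => M m || (g <= m)%MM) (maxn s t.+1).
Proof.
move=> upM degg [rF [dF [resF lenF]]] [rK [dK [resK lenK]]].
have [d res] := mapping_cone resF resK degg upM.
exists (cone_rank rF rK), d; split=> // [[//|i]]; rewrite gtn_max => /andP[lts ltt].
by rewrite /= /cone_rank (lenF i.+1 lts : rF i = _) lenK.
Qed.

(** The Koszul complex: for a new variable z the colon ideal by z is the ideal
itself. *)
Lemma linearly_resolved_variable_seq (s : seq 'I_N) : uniq s ->
  linearly_resolved 1 (meets [set z in s]) (size s).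
Proof.
elim: s => [_ | z s IH /= /andP[zs us]].
  apply: eq_linearly_resolved (linearly_resolved0 1) => mo /=.
  by apply/esym/exists_inP => -[z]; rewrite !inE.
have res := IH us.
have eqM mo : meets [set z' in s] mo = meets [set z' in s] (mo + U_(z))%MM.
  apply: eq_existsb => z'; rewrite inE mnmDE mnm1E.
  by case: eqP => [<-|]; rewrite ?(negPf zs) ?addn0.
have := linearly_resolved_cone (@upclosed_meets N _) (mdeg1 z) res
  (eq_linearly_resolved eqM res).
rewrite (maxn_idPr (leqnSn _)); apply: eq_linearly_resolved => mo.
have leU : (U_(z) <= mo)%MM = (0 < mo z)%N.
  apply/mnm_lepP/idP => [/(_ z)|mz j]; rewrite mnm1E ?eqxx //.
  by case: eqP => [<-|].
rewrite leU; apply/orP/exists_inP => [[/exists_inP[z']|mz] | [z']].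
- by rewrite inE => zs' mz'; exists z' => //; rewrite !inE zs' orbT.
- by exists z; rewrite // !inE eqxx.
- rewrite !inE => /predU1P[-> | zs'] mz'; [by right | left].
  by apply/exists_inP; exists z'; rewrite ?inE.
Qed.

Lemma linearly_resolved_variables (Z : {set 'I_N}) :
  linearly_resolved 1 (meets Z) #|Z|.
Proof.
rewrite cardE; apply: eq_linearly_resolved (linearly_resolved_variable_seq (enum_uniq Z)).
by move=> mo; congr meets; apply/setP => z; rewrite inE mem_enum.
Qed.

Theorem linear_resolution_minimal c M gs s : (0 < c)%N ->
  (forall p, in_ideal gs p <-> mideal M p) -> linearly_resolved c M s ->
  exists F : graded_free_seq k N,
    [/\ minimal_graded_free_resolution gs F,
        forall i, (s < i)%N -> gf_rank F i = 0%N &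
        forall i (a : 'I_(gf_rank F i)),
          gf_deg a = if i is j.+1 then (c + j)%N else 0%N].
Proof.
move=> c0 gsM [r [d [res len]]].
exists {| gf_rank := aug_rank r;
  gf_deg := fun i _ => if i is j.+1 then (c + j)%N else 0%N;
  gf_d := d; gf_aug := 1%:M |}; split=> //; split=> /=.
- by move=> a; rewrite !ord1 mxE eqxx mulr1n dhomog1.
- move=> i a b _; have := lin_homog res a b.
  case: i a b => [|i] a b /=; first by rewrite addn0 subn0.
  by move=> dh; rewrite leq_add2l leqnSn subnDl subSnn.
- exists 1%:M; rewrite mulmx1 mxE eqxx mulr1n subrr.
  exact: (ideal0 (ideal_in_ideal _)).
- by move=> v; rewrite mulmx1 gsM; apply: (lin_image res).
- exact: (lin_exact res).
- move=> i a b; apply: (dhomog_nemf_coeff (lin_homog res a b)).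
  by rewrite mf0; case: (i) => //=; rewrite neq_ltn c0.
Qed.

End LinearResolutions.

(** * The linear resolution of a full staircase *)

Section FullStaircase.
Local Open Scope ring_scope.
Variables (k : fieldType) (m : nat) (h : rel 'I_m).
Hypotheses (stair : staircase h) (fullh : full h).
Notation V := ('I_m + 'I_m)%type.
Notation N := #|{: V}|.
Notation I := (edge_ideal k (bipartite_graph h)).
Local Notation xv a := (enum_rank (inl a : V)).
Local Notation yv a := (enum_rank (inr a : V)).

(** The edges x_a y_b that precede x_i y_j when edges are ordered by b, then
by a. *)
Definition before (i j : nat) (a b : 'I_m) : bool :=
  (a <= b)%N && ((b < j)%N || (b == j :> nat) && (a < i)%N).

Definition edges_before i j (mo : 'X_{1..N}) : bool :=
  [exists a : 'I_m, exists b : 'I_m,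
    [&& before i j a b, 0 < mo (xv a) & 0 < mo (yv b)]%N].

Lemma edges_beforeP i j (mo : 'X_{1..N}) :
  reflect (exists a b, [/\ before i j a b, 0 < mo (xv a) & 0 < mo (yv b)]%N)
          (edges_before i j mo).
Proof.
apply: (iffP existsP) => [[a /existsP[b /and3P H]] | [a [b H]]]; exists a.
  by exists b.
by apply/existsP; exists b; apply/and3P.
Qed.

(** The generators of the colon ideal by x_i y_j of the edges before it: x_a
with a < i, because of x_a y_j, and y_b with i <= b < j, because of x_i y_b. *)
Definition colon_vars (i j : nat) : {set V} :=
  [set v : V | match v with inl a => a < i | inr b => (i <= b) && (b < j) end]%N.

(** The indices of the variables run through 0, ..., j - 1 without repetition. *)
Lemma card_colon_vars i j : (i <= j)%N -> (j <= m)%N -> (#|colon_vars i j| <= j)%N.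
Proof.
move=> leij lejm.
have inj : {in colon_vars i j &, injective (@strip m)}.
  move=> [a|b] [a'|b']; rewrite !inE /= => H H' eqs; subst => //.
    by case/andP: H'; rewrite leqNgt H.
  by case/andP: H; rewrite leqNgt H'.
rewrite -(card_in_imset inj) -[X in (_ <= X)%N](card_ord_lt lejm).
apply/subset_leq_card/subsetP => _ /imsetP[v + ->]; rewrite !inE.
by case: v => [a /leq_trans-> // | b /andP[_]].
Qed.

(** Linear quotients. An edge x_a y_b with b < j either has a < i or has
i <= a <= b < j, and one of its variables is in [colon_vars]. *)
Lemma colon_edges_before (i j : 'I_m) (mo : 'X_{1..N}) : (i <= j)%N ->
  edges_before i j (mo + (U_(xv i) + U_(yv j)))%MM
  = meets (cover_vars (colon_vars i j)) mo.
Proof.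
move=> leij.
have xE a : (mo + (U_(xv i) + U_(yv j)))%MM (xv a) = (mo (xv a) + (i == a))%N.
  by rewrite !mnmDE !mnm1E !(inj_eq enum_rank_inj) /= addn0.
have yE b : (mo + (U_(xv i) + U_(yv j)))%MM (yv b) = (mo (yv b) + (j == b))%N.
  by rewrite !mnmDE !mnm1E !(inj_eq enum_rank_inj) /= add0n.
apply/edges_beforeP/exists_inP => [[a [b []]] | [_ /imsetP[v + ->]]].
  rewrite xE yE => /andP[leab]; case: ltngtP => //= [ltbj _ | eqbj ltai].
    have nebj : (j == b) = false by apply/eqP => eqj; rewrite eqj ltnn in ltbj.
    rewrite nebj addn0; case: (ltnP a i) => [ltai | leia] mx my.
      have neai : (i == a) = false by apply/eqP => eqi; rewrite eqi ltnn in ltai.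
      rewrite neai addn0 in mx.
      by exists (xv a); rewrite // mem_cover_vars inE.
    exists (yv b); rewrite // mem_cover_vars inE ltbj andbT.
    exact: leq_trans leia leab.
  have neai : (i == a) = false by apply/eqP => eqi; rewrite eqi ltnn in ltai.
  by rewrite neai addn0 => mx _; exists (xv a); rewrite // mem_cover_vars inE.
case: v => [a | b]; rewrite inE.
  move=> ltai mx; exists a, j; rewrite xE yE eqxx addn1 addn_gt0 mx /before eqxx ltai orbT andbT.
  by rewrite (ltnW (leq_trans ltai leij)).
case/andP=> leib ltbj my; exists i, b.
by rewrite xE yE eqxx addn1 addn_gt0 my /before ltbj leib.
Qed.

Lemma upclosed_edges_before i j : upclosed (edges_before i j).
Proof.
move=> mo mo' /edges_beforeP[a [b [ab mx my]]]; apply/edges_beforeP.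
by exists a, b; rewrite ab !mnmDE !addn_gt0 mx my.
Qed.

Lemma edges_beforeS (i j : 'I_m) (mo : 'X_{1..N}) : (i <= j)%N ->
  edges_before i j mo || (U_(xv i) + U_(yv j) <= mo)%MM = edges_before i.+1 j mo.
Proof.
move=> leij; rewrite lem_pair ?(inj_eq enum_rank_inj) //.
apply/orP/edges_beforeP => [[/edges_beforeP[a [b [/andP[leab H] mx my]]] | /andP[mx my]]|].
- exists a, b; split; rewrite // /before leab /=.
  by case/orP: H => [-> // | /andP[-> lt]]; rewrite (leq_trans lt) ?leqnSn ?orbT.
- by exists i, j; rewrite mx my /before leij eqxx ltnSn orbT.
case=> a [b [/andP[leab H] mx my]].
have [/andP[/eqP eqb /eqP eqa] | ne] := boolP ((b == j) && (a == i)).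
  by right; rewrite -eqb -eqa mx my.
left; apply/edges_beforeP; exists a, b; split; rewrite // /before leab /=.
case/orP: H => [-> // | /andP[eqb]]; rewrite eqb ltnS leq_eqVlt => /orP[/eqP eqa | ->].
  case/negP: ne; rewrite (_ : b = j) ?eqxx /=; last exact/val_inj/eqP.
  by apply/eqP/val_inj.
by rewrite orbT.
Qed.

Lemma edges_before_resolved j : (j <= m)%N ->
  linearly_resolved k 2 (edges_before 0 j) m.
Proof.
elim: j => [_ | j IH ltj].
  apply: (@linearly_resolvedW _ _ _ _ 0) => //.
  apply: eq_linearly_resolved (linearly_resolved0 k N 2) => mo.
  by apply/esym/edges_beforeP => -[a [b [/andP[_]]]]; rewrite andbF.
have step i : (i <= j.+1)%N -> linearly_resolved k 2 (edges_before i j) m.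
  elim: i => [_ | i IHi leij]; first exact: IH (ltnW ltj).
  have lti : (i < m)%N by apply: leq_trans ltj.
  have res := IHi (ltnW leij).
  pose i' := Ordinal lti; pose j' := Ordinal ltj.
  pose Z := cover_vars (colon_vars i j).
  have resZ : linearly_resolved k 1
      (fun mo => edges_before i j (mo + (U_(xv i') + U_(yv j')))%MM) #|Z|.
    apply: eq_linearly_resolved (linearly_resolved_variables k Z) => mo.
    by rewrite (colon_edges_before (i := i') (j := j')).
  have ltZ : (#|Z| < m)%N.
    apply: (leq_ltn_trans _ ltj); rewrite card_imset; last exact: enum_rank_inj.
    by apply: card_colon_vars => //; apply: ltnW.
  have deg2 : mdeg (U_(xv i') + U_(yv j'))%MM = 2%N by rewrite mdegD !mdeg1.
  have := linearly_resolved_cone (@upclosed_edges_before i j) deg2 res resZ.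
  rewrite (maxn_idPl ltZ); apply: eq_linearly_resolved => mo.
  exact: (edges_beforeS (i := i') (j := j')).
apply: eq_linearly_resolved (step j.+1 (leqnn _)) => mo.
apply: eq_existsb => a; apply: eq_existsb => b; congr (_ && _); rewrite /before.
rewrite ltn0 andbF orbF [(b < j.+1)%N]ltnS [(b <= j)%N]leq_eqVlt.
have [eqb | _] := eqVneq (b : nat) j; last by rewrite orbF.
by rewrite -eqb ltnn ltnS /= andbb andbT.
Qed.

Lemma full_edge_monomial (mo : 'X_{1..N}) :
  edge_monomial (bipartite_graph h) mo = edges_before 0 m mo.
Proof.
apply/edge_monomialP/edges_beforeP => [[u [v [uv mu mv]]] | [a [b [/andP[leab _] mx my]]]].
  have [a [b [leab [[eu ev]|[eu ev]]]]] := bipartite_edgeP stair uv; exists a, b;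
    by rewrite /before leab ltn_ord -?eu -?ev.
exists (inl a), (inr b); split=> //; exact: fullh.
Qed.

Theorem full_linear_resolution : exists F : graded_free_seq k N,
  [/\ minimal_graded_free_resolution I F,
      forall i, (m < i)%N -> gf_rank F i = 0%N &
      forall i (a : 'I_(gf_rank F i)),
        gf_deg a = if i is j.+1 then j.+2 else 0%N].
Proof.
have res := edges_before_resolved (leqnn m).
have [||F [resF lenF degF]] := linear_resolution_minimal (gs := I) _ _ res; first by [].
  move=> p; rewrite (in_edge_ideal (@bipartite_irr m h)).
  by rewrite (eq_mideal full_edge_monomial).
by exists F.
Qed.

End FullStaircase.

(** * The five conditions *)

Section Main.
Local Open Scope ring_scope.
Variables (k : fieldType) (m : nat) (h : rel 'I_m).
Hypothesis stair : staircase h.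
Notation V := ('I_m + 'I_m)%type.
Notation N := #|{: V}|.
Notation H := (bipartite_graph h).
Notation I := (edge_ideal k H).

Let irrH := @bipartite_irr m h.
Let symH := @bipartite_sym m h.

Lemma card_sides : #|{: V}| = (m + m)%N.
Proof. by rewrite card_sum card_ord. Qed.

Lemma betti_neq0 (F : graded_free_seq k N) i :
  (0 < gf_rank F i)%N -> exists a : 'I_(gf_rank F i), betti F i (gf_deg a) != 0%N.
Proof.
move=> rF; exists (Ordinal rF); rewrite /betti -lt0n; apply/card_gt0P.
by exists (Ordinal rF); rewrite inE.
Qed.

Lemma cover_resolution_rank (F : graded_free_seq k N) C :
  minimal_graded_free_resolution I F ->
  vertex_cover H C -> irredundant H C -> (0 < gf_rank F #|C|)%N.
Proof.
move=> resF covC irrC.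
have [u [nu Cu]] := irredundant_cover_socle k irrH covC irrC.
have reg := regular_variables k (enum_uniq (cover_vars C)).
have := resolution_length resF reg nu.
rewrite size_map -cardE card_imset; last exact: enum_rank_inj.
by apply=> _ /mapP[z + ->]; rewrite mem_enum; apply: Cu.
Qed.

Lemma staircase_krull_dim : has_krull_dim I m.
Proof.
have := edge_ideal_krull_dim k (left_side_cover h).
rewrite card_left_side [X in has_krull_dim I (X - _)]card_sides addKn; apply=> D.
exact: leq_card_cover.
Qed.

Lemma cohen_macaulay_full : cohen_macaulay I -> full h.
Proof.
case=> d [[[fs [homfs reg szfs]] _] [_ maxd]].
have [[P chP] _] := staircase_krull_dim.
apply: NNPP => /(not_full_cover stair)[C [covC irrC ltC]].
have := edge_ideal_depth_le irrH covC irrC homfs reg.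
rewrite szfs card_sides => /(leq_trans (maxd _ _ chP)).
rewrite leq_subRL; first by rewrite leq_add2r leqNgt ltC.
by rewrite -card_sides max_card.
Qed.

Lemma full_cohen_macaulay : full h -> cohen_macaulay I.
Proof.
move=> fullh; exists m; split; last exact: staircase_krull_dim.
split; first by exists (diff_vars k m); apply: full_regular_sequence.
move=> fs homfs reg.
have := edge_ideal_depth_le irrH (left_side_cover h) (left_side_irredundant stair) homfs reg.
by rewrite card_left_side [X in (_ <= X - _)%N]card_sides addKn.
Qed.

Lemma has_pd_full : has_pd I m -> full h.
Proof.
case=> F [resF _ maxF]; apply: NNPP => /(not_full_cover stair)[C [covC irrC ltC]].
have [a /maxF] := betti_neq0 (cover_resolution_rank resF covC irrC).
by rewrite leqNgt ltC.
Qed.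

Lemma full_rank_top (F : graded_free_seq k N) :
  minimal_graded_free_resolution I F -> (0 < gf_rank F m)%N.
Proof.
move=> resF.
have := cover_resolution_rank resF (left_side_cover h) (left_side_irredundant stair).
by rewrite card_left_side.
Qed.

Lemma betti_rank (F : graded_free_seq k N) i j :
  betti F i j != 0%N -> exists a : 'I_(gf_rank F i), gf_deg a = j.
Proof.
by rewrite /betti -lt0n => /card_gt0P[a]; rewrite inE => /eqP; exists a.
Qed.

Lemma full_has_pd : full h -> has_pd I m.
Proof.
move=> fullh; have [F [resF lenF _]] := full_linear_resolution k stair fullh.
exists F; split=> //.
  by have [a] := betti_neq0 (full_rank_top resF); exists (gf_deg a).
move=> i j /betti_rank[a _]; rewrite leqNgt; apply/negP => /lenF r0.
by have := ltn_ord a; rewrite [X in (_ < X)%N]r0.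
Qed.

Lemma has_reg_full : has_reg I 1 -> full h.
Proof.
case=> F [resF _ maxF] i j leij; apply/negPn/negP => nij.
have ltij : (i < j)%N.
  rewrite ltn_neqAle leij andbT; apply: contraNneq nij => /val_inj ->.
  exact: stair_diag.
have nji : ~~ h j i by apply/negP => /(stair_leq stair); rewrite leqNgt ltij.
have [|t degt] := @disjoint_edges_syzygy k V H symH irrH (inl i) (inr i) (inl j) (inr j) F
    (stair_diag stair i) (stair_diag stair j) _ resF.
  move=> u v; rewrite !inE => /orP[] /eqP-> /orP[] /eqP->; rewrite //=.
have /maxF : betti F 2 4 != 0%N.
  by rewrite -lt0n; apply/card_gt0P; exists t; rewrite inE degt.
by [].
Qed.

Lemma full_has_reg : (0 < m)%N -> full h -> has_reg I 1.
Proof.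
move=> m0 fullh; have [F [resF lenF degF]] := full_linear_resolution k stair fullh.
exists F; split=> //.
  have [a nz] := betti_neq0 (full_rank_top resF).
  exists m, (gf_deg a); split=> //; rewrite degF.
  by move: m0; case: (m) => // n _; rewrite addn1.
by move=> i j /betti_rank[a <-]; rewrite degF; case: i a => // i _; rewrite addn1.
Qed.

Lemma unmixed_full : unmixed H -> full h.
Proof.
move=> unm; apply: NNPP => /(not_full_cover stair)[C [covC irrC]].
have minL := irredundant_minset (left_side_cover h) (left_side_irredundant stair).
by rewrite -(unm _ _ minL (irredundant_minset covC irrC)) card_left_side ltnn.
Qed.

Lemma full_unmixed : full h -> unmixed H.
Proof.
move=> fullh C D /(minset_irredundant symH irrH)[covC irrC].
move=> /(minset_irredundant symH irrH)[covD irrD].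
by rewrite !(full_card_cover stair fullh).
Qed.

End Main.

Theorem proposition2p6 (k : fieldType) (m : nat) (e : rel 'I_m.+1)
    (hn : 2 <= m.+1)
    (simple_G : simple_graph e)
    (closed_G : closed_graph e)
    (connected_G : connected_graph e)
    (no_cut_G : forall v, ~ cut_point e v) :
  let H := initial_closed_graph e in
  [<-> cohen_macaulay (edge_ideal k H);
       has_pd (edge_ideal k H) m;
       unmixed H;
       forall i, mu H i = 0;
       has_reg (edge_ideal k H) 1].
Proof.
have [h eqH stair] :=
  initial_closed_graph_staircase simple_G closed_G connected_G no_cut_G.
move=> H; rewrite {}/H eqH; tfae.
- by move/(cohen_macaulay_full stair)/(full_has_pd k stair).
- by move/(has_pd_full stair)/(full_unmixed stair).
- by move/(unmixed_full stair)/(mu_eq0 stair).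
- by move/(mu_eq0 stair)/(full_has_reg k stair hn).
- by move/(has_reg_full stair)/(full_cohen_macaulay k stair).
Qed.
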